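(* Let $b\ge2$ be an integer, let $\mathcal S=(x_j)_{j\ge0}$ be a $(0,1)$-sequence in base $b$, and let $\widetilde{\mathcal S}=(\widetilde x_j)_{j\ge0}$ be obtained by applying a single full Owen scrambling to $\mathcal S$. Set $\widetilde P_n=(\widetilde x_j)_{0\le j<n}$ for $n\ge1$. Then, as $m\to\infty$, $$ b^{3m/2}R_\infty(\widetilde P_{b^m})\xrightarrow{\mathrm d}W_{2,1/2}\quad\text{(convergence in distribution)}. $$ Moreover, there are constants $C_b,c_b>0$, depending only on $b$, such that, almost surely, $$ R_\infty(\widetilde P_n)\le C_b n^{-3/2}(\log n)^{1/2}, \qquad \rho_\infty(\widetilde P_n)\ge c_b n^{1/2}(\log n)^{-1/2} $$ for all sufficiently large $n$.
   Context: A $b$-adic elementary interval in $[0,1)^d$ is a set $\prod_{j=1}^d[a_jb^{-k_j},(a_j+1)b^{-k_j})$ with $k_j\in\mathbb N_0$, $0\le a_j<b^{k_j}$. For $0\le t\le m$, a $(t,m,d)$-net in base $b$ is a $b^m$-point multiset in $[0,1)^d$ such that every $b$-adic elementary interval of volume $b^{t-m}$ contains exactly $b^t$ of its points. A $(t,d)$-sequence in base $b$ is an infinite sequence $(\boldsymbol x_n)_{n\ge0}$ in $[0,1)^d$ such that for every $k\ge0$ and $m\ge t$ the point set $\{\boldsymbol x_n:kb^m\le n<(k+1)b^m\}$ is a $(t,m,d)$-net in base $b$. Here $d=1$, $t=0$. Full Owen scrambling in base $b$: independently for each coordinate $j$ and each finite digit prefix $a_1\cdots a_{r-1}\in\{0,\dots,b-1\}^{r-1}$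 ($r\ge1$), choose a uniform random permutation $\pi_{j,a_1\cdots a_{r-1}}$ of $\{0,\dots,b-1\}$, all mutually independent. The $j$-th coordinate with base-$b$ digits $(a_r)_{r\ge1}$ (regular expansion, not ending in infinitely many digits $b-1$; for digital points, the specified output digits) is replaced by the number with digits $\widetilde a_r=\pi_{j,a_1\cdots a_{r-1}}(a_r)$. A single scrambling uses the same permutations for all points of the sequence. For an $N$-point multiset $P=(\boldsymbol x_n)_{0\le n<N}$ in $[0,1]^d$ with $N\ge2$: $R_\infty(P)=\min_{n<n'}\|\boldsymbol x_n-\boldsymbol x_{n'}\|_\infty$, $h_\infty(P)=\sup_{\boldsymbol z\in[0,1]^d}\min_{n}\|\boldsymbol z-\boldsymbol x_n\|_\infty$, $\rho_\infty(P)=2h_\infty(P)/R_\infty(P)$ ($=\infty$ if $R_\infty(P)=0$). $W_{\alpha,\lambda}$ denotes a Weibull random variable with $\mathbb P(W_{\alpha,\lambda}>t)=\exp(-\lambda t^\alpha)$, $t\ge0$. *)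

(* Defs.v *)
From HB Require Import structures.
From mathcomp Require Import all_boot all_order all_algebra all_fingroup.
From mathcomp Require Import all_classical all_reals all_analysis.

Set Implicit Arguments.
Unset Strict Implicit.
Unset Printing Implicit Defensive.

Import Order.TTheory GRing.Theory Num.Theory.
Import numFieldNormedType.Exports.

Local Open Scope classical_set_scope.
Local Open Scope ring_scope.

(* Everything is in dimension d = 1.  A finite point multiset is a [seq R],
   repetitions being allowed. *)

Definition elementary_interval (R : realType) (b k a : nat) : interval R :=
  `[a%:R / b%:R ^+ k, a.+1%:R / b%:R ^+ k[.

(* (t, m, 1)-net in base b, for t <= m.  The interval indexed by k has volume
   b^-k, so volume b^(t - m) means k = m - t. *)
Definition is_net (R : realType) (b t m : nat) (s : seq R) : Prop :=
  [/\ size s = (b ^ m)%N,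
      (forall y : R, y \in s -> 0 <= y < 1) &
      forall a : nat, (a < b ^ (m - t))%N ->
        count (fun y => y \in elementary_interval R b (m - t) a) s
        = (b ^ t)%N].

(* (t, 1)-sequence in base b. *)
Definition is_ts_sequence (R : realType) (b t : nat) (x : nat -> R) : Prop :=
  forall k m : nat, (t <= m)%N ->
    is_net b t m [seq x n | n <- iota (k * b ^ m) (b ^ m)].

(* Digit sequences are indexed from 0, so [a r] has weight b^-(r+1). *)
Definition digits_value (R : realType) (b : nat) (a : nat -> 'I_b) : R :=
  limn (series (fun r : nat => (a r : nat)%:R / (b%:R : R) ^+ r.+1)).

Definition regular_expansion (R : realType) (b : nat) (y : R)
    (a : nat -> 'I_b) : Prop :=
  digits_value R a = y /\
  forall N : nat, exists2 r : nat, (N <= r)%N & (a r : nat) <> b.-1.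

(* Mutual independence of the family (X i) of random elements of a finite
   type, each of them measurable for the discrete sigma-algebra. *)
Definition mutually_independent d (T : measurableType d) (R : realType)
    (P : probability T R) (I : eqType) (V : finType) (X : I -> T -> V) : Prop :=
  (forall (i : I) (A : set V), measurable (X i @^-1` A)) /\
  forall (s : seq I) (A : I -> set V), uniq s ->
    P [set w | forall i, i \in s -> A i (X i w)]
    = (\prod_(i <- s) P (X i @^-1` A i))%E.

(* The random permutations of a full Owen scrambling of one coordinate: one
   for each finite digit prefix, including the empty one. *)
Definition owen_permutations d (T : measurableType d) (R : realType)
    (P : probability T R) (b : nat)
    (pi : seq 'I_b -> T -> {perm 'I_b}) : Prop :=
  mutually_independent P pi /\
  forall (u : seq 'I_b) (s : {perm 'I_b}),
    P [set w | pi u w = s] = ((b`!)%:R^-1)%:E.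

(* The prefix selecting the permutation consists of the original digits. *)
Definition scramble_digits (b : nat) (p : seq 'I_b -> {perm 'I_b})
    (a : nat -> 'I_b) : nat -> 'I_b :=
  fun r => p (mkseq a r) (a r).

(* First n points of the scrambled sequence, where [a j] is the digit sequence
   of the j-th point and p is one realization of the permutations. *)
Definition scrambled_points (R : realType) (b : nat)
    (p : seq 'I_b -> {perm 'I_b}) (a : nat -> nat -> 'I_b) (n : nat) : seq R :=
  mkseq (fun j => digits_value R (scramble_digits p (a j))) n.

(* The inf ranges over a finite set, nonempty when [2 <= size s]. *)
Definition R_infty (R : realType) (s : seq R) : R :=
  inf [set `|s`_ij.1 - s`_ij.2| |
       ij in [set ij : nat * nat | (ij.1 < ij.2 < size s)%N]].

Definition h_infty (R : realType) (s : seq R) : R :=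
  sup [set inf [set `|z - y| | y in [set` s]] | z in `[0, 1]%classic].

Definition rho_infty (R : realType) (s : seq R) : \bar R :=
  if R_infty s == 0 then +oo%E else (2 * h_infty s / R_infty s)%:E.

(* Convergence of the distribution functions at every continuity point of the
   limit; the limit variable may live on another probability space. *)
Definition cvg_in_distribution (R : realType)
    d (T : measurableType d) (P : probability T R) (X : nat -> {RV P >-> R})
    d' (T' : measurableType d') (P' : probability T' R) (W : {RV P' >-> R})
    : Prop :=
  forall t : R, {for t, continuous (cdf W)} ->
    cdf (X m) t @[m --> \oo] --> cdf W t.

Definition is_weibull (R : realType) d (T : measurableType d)
    (P : probability T R) (W : {RV P >-> R}) (alpha lambda : R) : Prop :=
  forall t : R, 0 <= t -> ccdf W t = (expR (- (lambda * t `^ alpha)))%:E.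

(* Main.v *)
Require Import Defs.
From mathcomp Require Import all_boot all_order all_algebra all_fingroup.
From mathcomp Require Import all_classical all_reals all_analysis.
From mathcomp Require Import measurable_realfun zify ring lra.

(** Let [N = b^m].  The first [N] points of a (0,1)-sequence occupy each of the
    [N] cells [c / N <= y < (c + 1) / N] exactly once, and scrambling preserves this.
    The digits that follow the [m]-th one are scrambled by permutations attached
    to prefixes of length at least [m].  Distinct points have distinct such
    prefixes, so, whatever the permutations attached to shorter prefixes, the
    relative positions [U_c] of the points inside their cells are independent
    and uniform ([prob_exposure], [prob_subcells]).  Points in cells that are
    not neighbours are at distance at least [1 / N]; hence the separation radius
    is the minimum over [c] of [(1 + U_(c+1) - U_c) / N].

    A pair of neighbours is bad at level [s] when [1 + U_(c+1) - U_c < s], which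
    has probability [p = s^2 / 2].  In a bad pair the left position is larger
    than [1 - s] and the right one smaller than [s]; if [s <= 1 / 2] then the
    next pair cannot be bad.  Consequently the probability [q_n] that [n] points
    in a row have no bad pair satisfies the exact recurrence
    [q_(n+2) = q_(n+1) - p q_n] ([card_sortedSS]), which gives
    [exp (- n (p + 4 p^2)) <= q_(n+1) <= exp (- n p)] ([recurrence_ge],
    [recurrence_le]).  All this is done for positions truncated to finitely many
    digits, where probabilities are proportions of words and the truncation
    error is negligible ([R_infty_scrambled_ge], [R_infty_scrambled_le]).

    Taking [s = t / sqrt N], so that [N p] tends to [t^2 / 2], yields the Weibull
    limit ([cvg_scaled_R_infty]).  Taking [s] of order [sqrt (m / N)] makes the
    probability that there is no bad pair at most [exp (- m)], which is
    summable: by Borel-Cantelli the bound on the separation radius holds almost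
    surely along the powers of [b] ([ae_R_infty_pow]), and it extends to all [n]
    because the radius decreases when points are added ([R_infty_interpolate]).
    Finally [n] points have covering radius at least [1 / (2 n)]
    ([h_infty_ge]), which turns this bound into the one on the mesh ratio. *)

Set Implicit Arguments.
Unset Strict Implicit.
Unset Printing Implicit Defensive.

Import Order.TTheory GRing.Theory Num.Theory.
Import numFieldNormedType.Exports.

Local Open Scope classical_set_scope.
Local Open Scope ring_scope.

(** * Digits *)

Fixpoint digits_nat (b : nat) (a : nat -> 'I_b) (L : nat) : nat :=
  if L is L'.+1 then (digits_nat a L' * b + a L')%N else 0%N.

Lemma digits_nat_ltn (b : nat) (a : nat -> 'I_b) (L : nat) :
  (digits_nat a L < b ^ L)%N.
Proof.
elim: L => [|L IH] //=; rewrite expnS.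
have := ltn_ord (a L); nia.
Qed.

Lemma digits_nat_cat (b : nat) (a : nat -> 'I_b) (m K : nat) :
  digits_nat a (m + K)
  = (digits_nat a m * b ^ K + digits_nat (fun r => a (m + r)%N) K)%N.
Proof.
elim: K => [|K IH] /=; first by rewrite addn0 muln1 addn0.
by rewrite addnS /= IH mulnDl -mulnA -expnSr addnA.
Qed.

Lemma eq_digits_nat (b : nat) (a a' : nat -> 'I_b) (L : nat) :
  (forall r, (r < L)%N -> a r = a' r) -> digits_nat a L = digits_nat a' L.
Proof.
elim: L => [|L IH] //= eqa; rewrite eqa // IH // => r rL.
by apply: eqa; rewrite ltnW.
Qed.

Lemma digits_nat_inj (b : nat) (a a' : nat -> 'I_b) (L : nat) :
  digits_nat a L = digits_nat a' L -> forall r, (r < L)%N -> a r = a' r.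
Proof.
elim: L => [|L IH] //= eqd r.
have [ltb ltb'] := (ltn_ord (a L), ltn_ord (a' L)).
have eqL : a L = a' L :> nat.
  by have := congr1 (modn^~ b) eqd; rewrite /= !modnMDl !modn_small.
rewrite ltnS leq_eqVlt => /predU1P[->|]; first exact: val_inj.
by apply: IH; nia.
Qed.

Lemma digits_nat_surj (b K v : nat) : (0 < b)%N -> (v < b ^ K)%N ->
  exists a : nat -> 'I_b, digits_nat a K = v.
Proof.
move=> b0; elim: K v => [|K IH] v vlt.
  by exists (fun=> Ordinal b0); case: v vlt.
have /IH[a av] : (v %/ b < b ^ K)%N by rewrite ltn_divLR // -expnSr.
exists (fun r => if r == K then Ordinal (ltn_pmod v b0) else a r) => /=.
rewrite eqxx (@eq_digits_nat _ _ a) ?av -?divn_eq // => r rK.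
by rewrite ltn_eqF.
Qed.

Lemma series_digits (R : realType) (b : nat) (a : nat -> 'I_b) (L : nat) :
  series (fun r => (a r : nat)%:R / (b%:R : R) ^+ r.+1) L
  = (digits_nat a L)%:R / b%:R ^+ L.
Proof.
have b0 : b%:R != 0 :> R by rewrite pnatr_eq0 -lt0n (leq_ltn_trans _ (ltn_ord (a 0))).
elim: L => [|L IH]; first by rewrite seriesEnat /= big_geq // mul0r.
rewrite seriesSr IH /= natrD natrM exprS; field.
by rewrite expf_neq0 ?b0.
Qed.

Section DigitsValue.
Variables (R : realType) (b : nat) (a : nat -> 'I_b).

Let bR_gt0 : 0 < b%:R :> R.
Proof. by rewrite ltr0n (leq_ltn_trans _ (ltn_ord (a 0))). Qed.

Let low L : R := (digits_nat a L)%:R / b%:R ^+ L.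
Let high L : R := (digits_nat a L).+1%:R / b%:R ^+ L.


Let lowS L : low L.+1 = low L + (a L)%:R / b%:R ^+ L.+1.
Proof. by rewrite /low -!series_digits seriesSr. Qed.

Let highE L : high L = low L + (b%:R ^+ L)^-1.
Proof. by rewrite /high -addn1 natrD mulrDl mul1r. Qed.

Let low_nondecreasing : nondecreasing_seq low.
Proof.
apply/nondecreasing_seqP => L.
by rewrite lowS lerDl divr_ge0 // exprn_ge0 // ltW.
Qed.

Let highB L : high L - high L.+1 = (b.-1 - a L)%:R / b%:R ^+ L.+1.
Proof.
have b0 : (0 < b)%N by rewrite -(ltr0n R).
have aL : (a L <= b.-1)%N by have := ltn_ord (a L); lia.
have aux (l c q c1 : R) : c1 != 0 -> q != 0 ->
    l + q^-1 - (l + c / (c1 * q) + (c1 * q)^-1) = (c1 - 1 - c) / (c1 * q).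
  by move=> c10 q0; field; rewrite q0 c10.
by rewrite !highE lowS natrB // -subn1 natrB // exprS aux ?expf_neq0 ?gt_eqF.
Qed.

Let highS_le L : high L.+1 <= high L.
Proof. by rewrite -subr_ge0 highB divr_ge0 // exprn_ge0 // ltW. Qed.

Let high_nonincreasing : nonincreasing_seq high.
Proof. by apply/nonincreasing_seqP. Qed.

Let low_le_high L M : low L <= high M.
Proof.
apply: (@le_trans _ _ (low (maxn L M))).
  by apply: low_nondecreasing; rewrite leq_maxl.
apply: (@le_trans _ _ (high (maxn L M))).
  by rewrite highE lerDl invr_ge0 exprn_ge0 // ltW.
by apply: high_nonincreasing; rewrite leq_maxr.
Qed.

Lemma is_cvg_series_digits :
  cvgn (series (fun r => (a r : nat)%:R / (b%:R : R) ^+ r.+1)).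
Proof.
rewrite (_ : series _ = low); last by apply/funext => L; exact: series_digits.
apply: nondecreasing_is_cvgn => //.
by exists (high 0) => _ [L _ <-]; exact: low_le_high.
Qed.

Let cvg_low : low @ \oo --> digits_value R a.
Proof.
rewrite (_ : low = series (fun r => (a r : nat)%:R / (b%:R : R) ^+ r.+1)).
  exact: is_cvg_series_digits.
by apply/funext => L; rewrite series_digits.
Qed.

Lemma digits_value_ge (L : nat) :
  (digits_nat a L)%:R / b%:R ^+ L <= digits_value R a.
Proof.
rewrite -/(low L) -(cvg_lim _ cvg_low) //.
by apply: nondecreasing_cvgn_le => //; apply/cvg_ex; eexists; exact: cvg_low.
Qed.

Lemma digits_value_le (L : nat) :
  digits_value R a <= (digits_nat a L).+1%:R / b%:R ^+ L.
Proof.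
rewrite -/(high L) -(cvg_lim _ cvg_low) //.
apply: limr_le; first by apply/cvg_ex; eexists; exact: cvg_low.
by apply: nearW => M; exact: low_le_high.
Qed.

(** A digit other than [b - 1] at some later position [r] leaves room below the
    right end of the cell. *)
Lemma digits_value_lt (L : nat) :
  (exists2 r, (L <= r)%N & (a r : nat) <> b.-1) ->
  digits_value R a < (digits_nat a L).+1%:R / b%:R ^+ L.
Proof.
case=> r Lr /eqP ar; apply: le_lt_trans (digits_value_le r.+1) _.
rewrite -/(high _) -/(high _); apply: lt_le_trans (high_nonincreasing Lr).
rewrite -subr_gt0 highB divr_gt0 ?exprn_gt0 // ltr0n subn_gt0.
by have := ltn_ord (a r); lia.
Qed.

End DigitsValue.

(** * Independent finite-valued random elements *)

Lemma measure_partition d (T : measurableType d) (R : realType)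
    (P : probability T R) (V : finType) (Y : T -> V) (A : set T) :
  (forall v, measurable (A `&` [set w | Y w = v])) ->
  measurable A /\ P A = (\sum_(v : V) P (A `&` [set w | Y w = v]))%E.
Proof.
move=> mA.
have -> : A = \bigcup_(v in [set: V]) (A `&` [set w | Y w = v]).
  by apply/seteqP; split=> [w Aw|w [v _ []]//]; exists (Y w).
split; first by apply: fin_bigcup_measurable => // v _; exact: finite_finset.
rewrite measure_fin_bigcup //; first last.
- by move=> v v' _ _ [w [[_ <-] [_ <-]]].
- exact: finite_finset.
rewrite (fsbigE (index_enum V)) ?index_enum_uniq //; first last.
  by move=> v _; rewrite mem_index_enum.
rewrite big_mkcond /=; apply: eq_bigr => v _; rewrite in_setT.
congr (P _); apply/seteqP; split=> w.
  by case=> Aw Yv; split=> //; exists v.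
by move=> [[v' _ [Aw _]] Yv].
Qed.

Section Independence.
Context d (T : measurableType d) (R : realType) (P : probability T R).
Variables (I : eqType) (V : finType) (X : I -> T -> V).

Definition update (f : I -> V) (i : I) (x : V) : I -> V :=
  fun k => if k == i then x else f k.

(** An event that reads finitely many of the variables is a finite union of
    events on which those variables are fixed. *)
Lemma measurable_finitary (s : seq I) (Q : (I -> V) -> Prop) :
  mutually_independent P X ->
  (forall f g, {in s, f =1 g} -> Q f -> Q g) ->
  measurable [set w | Q (X^~ w)].
Proof.
case=> mX _; elim: s Q => [|i s IH] Q Qs.
  have [[f Qf]|nQ] := pselect (exists f, Q f).
    rewrite (_ : [set _ | _] = setT) //.
    by apply/seteqP; split=> // w _; apply: Qs Qf.
  rewrite (_ : [set _ | _] = set0) //.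
  by apply/seteqP; split=> // w Qw; apply: nQ; exists (X^~ w).
apply: (measure_partition P (Y := X i) _).1 => v.
rewrite (_ : _ `&` _ =
    [set w | Q (update (X^~ w) i v)] `&` X i @^-1` [set v]); last first.
  by apply/seteqP; split=> w /= [Qw Xv]; split=> //; apply: Qs Qw => k _;
     rewrite /update; case: eqP => // ->.
apply: measurableI => //; apply: (IH (fun f => Q (update f i v))) => f g fg.
apply: Qs => k; rewrite /update inE; case: eqP => //= _; exact: fg.
Qed.

(** The variables indexed by [s1] are exposed first, and the targets [A] of the
    variables indexed by [s2] may depend on what they show.  If, whatever is
    shown, the targets are hit with the same probability [c], then they are hit
    with probability [c].  The events [A0] record, in the induction on [s1],
    the values exposed so far. *)
Lemma prob_exposure (s0 s1 s2 : seq I) (A0 : I -> set V)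
    (A : (I -> V) -> I -> set V) (c : \bar R) :
  mutually_independent P X -> uniq (s0 ++ s1 ++ s2) ->
  (forall f g, {in s1, f =1 g} -> A f = A g) ->
  (forall f, (\prod_(i <- s2) P (X i @^-1` A f i))%E = c) ->
  let E := [set w | (forall i, i \in s0 -> A0 i (X i w)) /\
                    (forall i, i \in s2 -> A (X^~ w) i (X i w))] in
  measurable E /\ P E = ((\prod_(i <- s0) P (X i @^-1` A0 i)) * c)%E.
Proof.
move=> hX; have [mX indX] := hX.
elim: s1 s0 A0 A => [|i s1 IH] s0 A0 A us As Ac E; rewrite /E.
  split.
    apply: (@measurable_finitary (s0 ++ s2) (fun f =>
      (forall i, i \in s0 -> A0 i (f i)) /\
      (forall i, i \in s2 -> A f i (f i)))) => // f g fg [f0 f2].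
    split=> i si; first by rewrite -fg ?mem_cat ?si //; exact: f0.
    by rewrite -fg ?mem_cat ?si ?orbT // (As g f) //; exact: f2.
  have [w0 _] : [set: T] !=set0.
    by apply/set0P/eqP => T0; have := probability_setT P; rewrite T0 measure0;
       move/eqP; rewrite eq_sym onee_eq0.
  set f0 := X^~ w0; rewrite -(Ac f0).
  pose B i := if i \in s0 then A0 i else A f0 i.
  rewrite (_ : [set _ | _] = [set w | forall i, i \in s0 ++ s2 -> B i (X i w)]).
    rewrite indX // big_cat /=; congr (_ * _)%E; apply: eq_big_seq => i.
      by rewrite /B => ->.
    move: us; rewrite cat_uniq => /and3P[_ /hasPn us _] si.
    by rewrite /B (negbTE (us _ si)).
  move: us; rewrite cat_uniq => /and3P[_ /hasPn us _].
  apply/seteqP; split=> w /=.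
    move=> [w0' w2] i; rewrite mem_cat /B; case: ifP => //= si; first by move=> _; exact: w0'.
    by move=> si2; rewrite (As _ (X^~ w)) //; exact: w2.
  move=> w2; split=> i si.
    by have := w2 i; rewrite mem_cat /B si /=; exact.
  have := w2 i; rewrite mem_cat /B si orbT (negbTE (us _ si)) => /(_ isT).
  by rewrite (As _ (X^~ w)).
have uis : uniq ((i :: s0) ++ s1 ++ s2).
  by have := uniq_catCA s0 [:: i] (s1 ++ s2); rewrite us => <-.
have is0 : i \notin s0.
  by move: uis; rewrite /= mem_cat negb_or => /andP[/andP[]].
have is2 : i \notin s2.
  by move: uis; rewrite /= !mem_cat !negb_or => /andP[/and3P[]].
have step v := IH (i :: s0) (fun k => if k == i then [set v] else A0 k)
  (fun f => A (update f i v)) uis.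
have piece v : E `&` [set w | X i w = v] =
  [set w | (forall k, k \in i :: s0 ->
             (if k == i then [set v] else A0 k) (X k w)) /\
           (forall k, k \in s2 -> A (update (X^~ w) i v) k (X k w))].
  apply/seteqP; split=> w /=.
    move=> [[w0 w2] Xv]; split=> k.
      by rewrite inE; case: eqP => //= [->|_]; [|exact: w0].
    move=> k2; rewrite (As _ (X^~ w)); first exact: w2.
    by move=> l _; rewrite /update; case: eqP => // ->.
  move=> [w0 w2].
  have Xv : X i w = v by have := w0 i; rewrite inE eqxx => /(_ isT).
  split=> //; split=> k ks.
    have := w0 k; rewrite inE ks orbT; case: eqP => [ki|_]; last exact.
    by rewrite ki (negbTE is0) in ks.
  rewrite (As _ (update (X^~ w) i v)); first exact: w2.
  by move=> l _; rewrite /update; case: eqP => // ->.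
have {}step v : measurable (E `&` [set w | X i w = v]) /\
    P (E `&` [set w | X i w = v]) = (P (X i @^-1` [set v]) *
      ((\prod_(k <- s0) P (X k @^-1` A0 k)) * c))%E.
  rewrite piece; have [|f|mEv PEv] := step v.
  - move=> f g fg; apply: As => k; rewrite /update inE; case: eqP => //= _.
    exact: fg.
  - exact: Ac.
  split=> //; rewrite PEv big_cons eqxx muleA; congr (_ * _ * _)%E.
  by apply: eq_big_seq => k ks; case: eqP => // ki; rewrite ki (negbTE is0) in ks.
have [mE ->] := measure_partition P (Y := X i) (fun v => (step v).1).
split=> //; under eq_bigr => v _ do rewrite (step v).2.
rewrite -ge0_sume_distrl; last by move=> *; exact: measure_ge0.
have [_] := measure_partition P (Y := X i) (A := setT)
  (fun v => measurableI _ _ measurableT (mX i [set v])).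
rewrite probability_setT; under eq_bigr do rewrite setTI.
by move=> /esym ->; rewrite mul1e.
Qed.

End Independence.

(** * Cells and positions inside cells *)

(** A scrambled digit is obtained by a permutation that depends on the preceding
    original digits only, so the original digits can be recovered one after the
    other. *)
Lemma scramble_digits_inj (b : nat) (p : seq 'I_b -> {perm 'I_b})
    (a a' : nat -> 'I_b) (m : nat) :
  (forall r, (r < m)%N -> scramble_digits p a r = scramble_digits p a' r) ->
  forall r, (r < m)%N -> a r = a' r.
Proof.
move=> eqs r; elim/ltn_ind: r => r IH rm; have := eqs r rm.
rewrite /scramble_digits (_ : mkseq a r = mkseq a' r); first by move/perm_inj.
apply/eq_in_map => i; rewrite mem_iota add0n => /= ir.
by apply: IH => //; exact: ltn_trans rm.
Qed.

(** Two points with the same first [m] digits lie in the same elementary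
    interval of length [b^-m]; half-openness of that interval is where the
    expansions have to be regular. *)
Lemma net_prefix_inj (R : realType) (b : nat) (x : nat -> R)
    (a : nat -> nat -> 'I_b) (m : nat) :
  is_ts_sequence b 0 x -> (forall j, regular_expansion (x j) (a j)) ->
  forall j j', (j < b ^ m)%N -> (j' < b ^ m)%N ->
    (forall r, (r < m)%N -> a j r = a j' r) -> j = j'.
Proof.
move=> xnet areg j j' jN j'N eqa.
have [_ _] := xnet 0%N m (leq0n m); rewrite mul0n subn0 expn0.
move=> /(_ _ (digits_nat_ltn (a j) m)).
have mem k : digits_nat (a k) m = digits_nat (a j) m ->
    x k \in elementary_interval R b m (digits_nat (a j) m).
  move=> <-; have [<- kreg] := areg k.
  by rewrite in_itv /= digits_value_ge digits_value_lt.
rewrite count_map; apply: contra_eq => jj'; rewrite neq_ltn; apply/orP; right.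
rewrite -size_filter.
have : {subset [:: j; j'] <= seq.filter (preim x (fun y => y \in
    elementary_interval R b m (digits_nat (a j) m))) (iota 0 (b ^ m))}.
  move=> k; rewrite !inE mem_filter mem_iota add0n /= => /orP[]/eqP ->.
    by rewrite mem.
  by rewrite mem // (eq_digits_nat eqa).
by move/uniq_leq_size; apply; rewrite /= inE jj'.
Qed.

Section Cells.
Variables (b m K : nat) (a : nat -> nat -> 'I_b).
Implicit Types p : seq 'I_b -> {perm 'I_b}.

Definition cell p (j : nat) : 'I_(b ^ m) :=
  Ordinal (digits_nat_ltn (scramble_digits p (a j)) m).

Definition subcell p (j : nat) : 'I_(b ^ K) :=
  Ordinal (digits_nat_ltn (fun r => scramble_digits p (a j) (m + r)) K).

Definition point_in_cell p : 'I_(b ^ m) -> 'I_(b ^ m) :=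
  finv (fun j : 'I_(b ^ m) => cell p j).

(** Position, at resolution [b^-K] relative to the cell, of the point found in
    each cell, cells being read from left to right. *)
Definition subcells p : (b ^ m).-tuple 'I_(b ^ K) :=
  [tuple subcell p (point_in_cell p c) | c < b ^ m].

Hypothesis a_inj : forall j j', (j < b ^ m)%N -> (j' < b ^ m)%N ->
  (forall r, (r < m)%N -> a j r = a j' r) -> j = j'.

Lemma cell_inj p : injective (fun j : 'I_(b ^ m) => cell p j).
Proof.
move=> j j' /(congr1 val) /= eqc; apply/val_inj/(a_inj (ltn_ord j) (ltn_ord j')).
exact: scramble_digits_inj (digits_nat_inj eqc).
Qed.

Lemma point_in_cellK p c : cell p (point_in_cell p c) = c.
Proof. exact: f_finv (@cell_inj p) c. Qed.

Lemma cellK p (j : 'I_(b ^ m)) : point_in_cell p (cell p j) = j.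
Proof. exact: finv_f (@cell_inj p) j. Qed.

Let prefix_inj (j j' : 'I_(b ^ m)) i i' :
  mkseq (a j) (m + i) = mkseq (a j') (m + i') -> j = j' /\ i = i'.
Proof.
move=> eqs; have := congr1 size eqs; rewrite !size_mkseq => /addnI eqi.
split=> //; apply/val_inj/(a_inj (ltn_ord j) (ltn_ord j')) => r rm.
have := congr1 (nth (a j r) ^~ r) eqs.
by rewrite !nth_mkseq ?eqi // ltn_addr.
Qed.

Section Law.
Context d (T : measurableType d) (R : realType) (P : probability T R).
Variable pi : seq 'I_b -> T -> {perm 'I_b}.
Hypothesis hpi : owen_permutations P pi.

(** Composition with the transposition of two digits shows that all the images
    of [x] are equally likely. *)
Lemma prob_perm_at (u : seq 'I_b) (x y : 'I_b) :
  P (pi u @^-1` [set s : {perm 'I_b} | s x = y]) = (b%:R^-1)%:E.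
Proof.
have [[mpi _] upi] := hpi.
pose r z : R := \sum_(s : {perm 'I_b} | s x == z) (b`!)%:R^-1.
have Pr z : P (pi u @^-1` [set s : {perm 'I_b} | s x = z]) = (r z)%:E.
  have [|_ ->] := measure_partition P (Y := pi u)
      (A := pi u @^-1` [set s : {perm 'I_b} | s x = z]).
    by move=> s; exact: measurableI (mpi u _) (mpi u [set s]).
  rewrite /r -sumEFin [RHS]big_mkcond /=; apply: eq_bigr => s _.
  case: ifP => [/eqP sz|/eqP sz].
    rewrite -(upi u s); congr (P _); apply/seteqP; split=> w /=; first by case.
    by move=> ->.
  rewrite (_ : _ `&` _ = set0) ?measure0 //.
  by apply/seteqP; split=> w //= [pz ps]; apply: sz; rewrite -ps.
have rC z : r z = r y.
  rewrite /r (reindex_inj (mulIg (tperm y z))) /=; apply: eq_bigl => s.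
  by rewrite permM -[X in _ == X](tpermL y z) (inj_eq perm_inj).
have [|_] := measure_partition P (Y := fun w => pi u w x) (A := setT).
  by move=> z; rewrite setTI; exact: (mpi u [set s : {perm 'I_b} | s x = z]).
rewrite probability_setT; under eq_bigr do rewrite setTI Pr rC.
rewrite sumEFin sumr_const card_ord Pr => /eqP.
rewrite eqe => /eqP r1; congr (_%:E).
have b0 : b%:R != 0 :> R 
  by rewrite pnatr_eq0 -lt0n (leq_ltn_trans _ (ltn_ord x)).
by apply: (mulIf b0); rewrite mulr_natr -r1 mulVf.
Qed.

(** The positions inside the cells are independent and uniform.  Which point lies
    in which cell is decided by the permutations attached to prefixes shorter
    than [m].  Once these are exposed, the position of each point is read off
    permutations attached to longer prefixes; no two points share such a prefix,
    and each digit takes its prescribed value with probability [1 / b]. *)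
Lemma prob_subcells (v : (b ^ m).-tuple 'I_(b ^ K)) :
  measurable [set w | subcells (pi^~ w) = v] /\
  P [set w | subcells (pi^~ w) = v] = ((b ^ K)%:R ^- (b ^ m))%:E.
Proof.
have b0 : (0 < b)%N by exact: leq_ltn_trans (ltn_ord (a 0 0)).
have [dg dgE] : {dg : 'I_(b ^ K) -> nat -> 'I_b | forall z, digits_nat (dg z) K = z}.
  pose dg (z : 'I_(b ^ K)) := cid (digits_nat_surj b0 (ltn_ord z)).
  by exists (fun z => sval (dg z)) => z; case: (dg z).
(* [s1] lists the prefixes that decide the cells, [s2] those that decide the
   positions inside the cells. *)
pose s1 := undup [seq mkseq (a j) r | j : 'I_(b ^ m) <- enum 'I_(b ^ m), r : nat <- iota 0 m].
pose s2 := [seq mkseq (a j) (m + i) | j : 'I_(b ^ m) <- enum 'I_(b ^ m), i : nat <- iota 0 K].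
pose A (f : seq 'I_b -> {perm 'I_b}) u := [set s : {perm 'I_b} |
  forall (j : 'I_(b ^ m)) i, (i < K)%N -> u = mkseq (a j) (m + i) ->
    s (a j (m + i)%N) = dg (tnth v (cell f j)) i].
have us : uniq ([::] ++ s1 ++ s2).
  rewrite /= cat_uniq undup_uniq /=; apply/andP; split.
    apply/hasPn => _ /allpairsP[[j i] /= [_ _ ->]]; rewrite mem_undup.
    apply/negP => /allpairsP[[j' r] /= [_ ri /(congr1 size)]].
    by move: ri; rewrite mem_iota !size_mkseq => /andP[_]; lia.
  apply: allpairs_uniq; [exact: enum_uniq|exact: iota_uniq|].
  by move=> [j i] [j' i'] _ _ /= /prefix_inj[-> ->].
have As f g : {in s1, f =1 g} -> A f = A g.
  move=> fg; apply/funext => u; rewrite /A.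
  suff cfg (j : 'I_(b ^ m)) : cell f j = cell g j.
    by apply/seteqP; split=> s /= hs j i iK ui; rewrite hs // cfg.
  apply/val_inj/eq_digits_nat => r rm; rewrite /scramble_digits fg //.
  by rewrite mem_undup; apply: allpairs_f; rewrite ?mem_enum // mem_iota.
have Ac f : (\prod_(u <- s2) P (pi u @^-1` A f u))%E = ((b ^ K)%:R ^- (b ^ m))%:E.
  rewrite (eq_big_seq (fun=> (b%:R^-1 : R)%:E)); last first.
    move=> _ /allpairsP[[j i] /= [_ iK ->]].
    rewrite -(prob_perm_at (mkseq (a j) (m + i)) (a j (m + i)%N)
      (dg (tnth v (cell f j)) i)).
    congr (P _); apply/seteqP; split=> w /=.
      by apply; move: iK; rewrite // mem_iota.
    by move=> pw j' i' i'K /prefix_inj[<- <-].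
  rewrite prodEFin big_const_seq count_predT iter_mulr_1 size_allpairs size_enum_ord size_iota.
  by rewrite exprVn natrX -exprM mulnC.
rewrite (_ : [set _ | _] = [set w |
  (forall u, u \in [::] -> [set: {perm 'I_b}] (pi u w)) /\
  (forall u, u \in s2 -> A (pi^~ w) u (pi u w))]).
  have [? ->] := prob_exposure (fun=> setT) hpi.1 us As Ac.
  by rewrite big_nil mul1e.
apply/seteqP; split=> w /=.
  move=> Uv; split=> // u _ j i iK ->.
  have : subcell (pi^~ w) j = tnth v (cell (pi^~ w) j).
    by rewrite -Uv tnth_mktuple cellK.
  move=> /(congr1 val) /=; rewrite -(dgE (tnth _ _)).
  by move/digits_nat_inj; exact.
case=> _ hA; apply/eq_from_tnth => c; rewrite tnth_mktuple.
set j := point_in_cell _ c; apply/val_inj => /=.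
rewrite -[c](point_in_cellK (pi^~ w)) -/j -dgE; apply: eq_digits_nat => i iK.
apply: (hA (mkseq (a j) (m + i))) => //.
by apply: allpairs_f; rewrite ?mem_enum // mem_iota.
Qed.

End Law.
End Cells.

(** * Counting words without two bad neighbours *)

Section Words.
Variables (T : finType) (e : rel T).

Lemma card_tupleS (n : nat) (p : pred (seq T)) :
  #|[set t : n.+1.-tuple T | p t]%SET|
  = (\sum_x #|[set t : n.-tuple T | p (x :: t)]%SET|)%N.
Proof.
under [RHS]eq_bigr do rewrite -sum1dep_card.
rewrite -sum1dep_card pair_big_dep /=.
rewrite (reindex (fun u : T * n.-tuple T => cons_tuple u.1 u.2)) //=.
exists (fun t : n.+1.-tuple T => (thead t, behead_tuple t)) => [[x t] _|t _].
  by congr (_, _); apply/val_inj.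
by rewrite /= [RHS]tuple_eta; apply/val_inj.
Qed.

(** A letter followed by an admissible word of length [n.+1] either is an
    admissible word or begins with a bad pair.  In the latter case the next pair
    is automatically good, so that the bad pair and the rest of the word can be
    chosen independently, the rest being any admissible word of length [n]. *)
Lemma card_sortedSS (n : nat) :
  (forall x y z, ~~ e x y -> e y z) ->
  (#|[set t : n.+2.-tuple T | sorted e t]%SET|
    + #|[set u : T * T | ~~ e u.1 u.2]%SET| * #|[set t : n.-tuple T | sorted e t]%SET|
   = #|T| * #|[set t : n.+1.-tuple T | sorted e t]%SET|)%N.
Proof.
move=> nbad; pose c y := #|[set t : n.-tuple T | path e y t]%SET|.
have -> : (#|[set t : n.+1.-tuple T | sorted e t]%SET| = \sum_y c y)%N.
  exact: card_tupleS.
have -> : (#|[set t : n.+2.-tuple T | sorted e t]%SET|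
           = \sum_x \sum_(y | e x y) c y)%N.
  rewrite card_tupleS; apply: eq_bigr => x _ /=.
  rewrite (card_tupleS n (path e x)) [RHS]big_mkcond /=; apply: eq_bigr => y _.
  case: (e x y) => //=; apply/eqP; rewrite cards_eq0; apply/eqP/setP => t.
  by rewrite !inE.
rewrite -sum1dep_card big_distrl /=.
rewrite [X in (_ + X)%N](eq_bigr (fun u : T * T => c u.2)); last first.
  move=> [x y] /= bxy; rewrite mul1n; apply: eq_card => t; rewrite !inE.
  by case: (tval t) => //= z s; rewrite (nbad _ _ _ bxy).
rewrite -(pair_big_dep xpredT (fun x y => ~~ e x y) (fun _ y => c y)) /=.
rewrite -big_split /= -sum_nat_const; apply: eq_bigr => x _.
by rewrite [RHS](bigID (e x)).
Qed.

End Words.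

Lemma sum_subn_ord (S M : nat) : (S <= M)%N ->
  (2 * \sum_(x < M) (S - x) = S * S.+1)%N.
Proof.
elim: M S => [|M IH] [|S] SM //; first by rewrite big_ord0.
  by rewrite big1.
rewrite big_ord_recl mulnDr subn0.
under eq_bigr do rewrite /bump subSS.
by rewrite IH //; lia.
Qed.

(** A bad pair has [x] within [S] of the right end and [y] within [S] of the left
    end, the two distances adding up to less than [S]: these pairs form a
    triangle. *)
Lemma card_bad (S M : nat) : (S <= M)%N ->
  (2 * #|[set u : 'I_M * 'I_M | ~~ (S + u.1 < M + u.2)]%SET| = S * S.+1)%N.
Proof.
move=> SM; rewrite -(sum_subn_ord SM) (reindex_inj rev_ord_inj) /=.
congr (2 * _)%N; rewrite -sum1dep_card.
rewrite -(pair_big_dep xpredT (fun x y : 'I_M => ~~ (S + x < M + y)%N)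
  (fun _ _ => 1%N)) /=.
apply: eq_bigr => x _; rewrite sum1dep_card.
have kM : (S - (M - x.+1) <= M)%N by lia.
have widen_inj : injective (widen_ord kM).
  by move=> y z /(congr1 val) /= /val_inj.
rewrite -[RHS]card_ord -(fintype.card_image widen_inj).
apply: eq_card => y; rewrite !inE -leqNgt; apply/idP/fintype.imageP => [yx|[z _ ->]].
  have yk : (y < S - (M - x.+1))%N by have := ltn_ord x; lia.
  by exists (Ordinal yk) => //; apply: val_inj.
by have := ltn_ord z; have := ltn_ord x; rewrite /=; lia.
Qed.

(** The ratio [q n / q n.+1] stays below any [1 + theta] with
    [p (1 + theta)^2 <= theta], because such a bound reproduces itself through
    the recurrence; this gives the lower bound on [q].  The upper bound holds
    because [q] decreases, so that [q n.+2 <= (1 - p) q n.+1]. *)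
Section Recurrence.
Variables (R : realType) (p theta : R) (q : nat -> R).
Hypotheses (p_ge0 : 0 <= p) (theta_ge0 : 0 <= theta).
Hypothesis theta_ge : p * (1 + theta) ^+ 2 <= theta.
Hypotheses (q0 : q 0 = 1) (q1 : q 1 = 1).
Hypothesis qSS : forall n, q n.+2 = q n.+1 - p * q n.

Let one_le : 1 <= (1 + theta) * (1 - p * (1 + theta)).
Proof.
rewrite (_ : _ * _ = 1 + (theta - p * (1 + theta) ^+ 2)); last by ring.
by rewrite lerDl subr_ge0.
Qed.

Let ratio n : 0 < q n.+1 /\ q n <= (1 + theta) * q n.+1.
Proof.
elim: n => [|n [qn qr]]; first by rewrite q0 q1 mulr1 lerDl.
have t1 : 0 < 1 + theta by rewrite ltr_wpDr.
have low : q n.+1 * (1 - p * (1 + theta)) <= q n.+2.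
  rewrite qSS mulrBr mulr1 lerD2l lerN2 mulrCA.
  by apply: ler_wpM2l => //; rewrite mulrC.
have pt : 0 < 1 - p * (1 + theta) by rewrite -(pmulr_rgt0 _ t1) (lt_le_trans ltr01).
split; first by apply: lt_le_trans low; exact: mulr_gt0.
apply: le_trans (_ : (1 + theta) * (q n.+1 * (1 - p * (1 + theta))) <= _).
  by rewrite mulrCA ler_peMr // ltW.
by rewrite ler_pM2l.
Qed.

Let q_gt0 n : 0 < q n.
Proof. by case: n => [|n]; [rewrite q0|have [] := ratio n]. Qed.

Lemma recurrence_ge (n : nat) : expR (- (n%:R * theta)) <= q n.+1.
Proof.
elim: n => [|n IH]; first by rewrite mul0r oppr0 expR0 q1.
have [qn2 qr] := ratio n.+1.
rewrite -natr1 mulrDl mul1r opprD expRD [expR (- theta)]expRN.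
rewrite ler_pdivrMr ?expR_gt0 // [leRHS]mulrC.
apply: le_trans IH _; apply: le_trans qr _.
by rewrite ler_wpM2r ?expR_ge1Dx // ltW.
Qed.

Lemma recurrence_le (n : nat) : q n.+1 <= expR (- (n%:R * p)).
Proof.
elim: n => [|n IH]; first by rewrite mul0r oppr0 expR0 q1.
rewrite -natr1 mulrDl mul1r opprD expRD mulrC.
have anti : q n.+1 <= q n.
  case: (n) => [|k]; first by rewrite q0 q1.
  by rewrite qSS lerBlDr lerDl mulr_ge0 // ltW // q_gt0.
apply: (@le_trans _ _ ((1 - p) * q n.+1)).
  by rewrite qSS mulrBl mul1r lerD2l lerN2 ler_wpM2l.
apply: (@le_trans _ _ (expR (- p) * q n.+1)).
  by rewrite ler_wpM2r ?expR_ge1Dx // ltW // q_gt0.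
by rewrite ler_wpM2l // expR_ge0.
Qed.

End Recurrence.

(** The least solution of [p (1 + theta)^2 <= theta] is [p + 2 p^2 + O(p^3)], so
    [p + 4 p^2] leaves room for the remainder. *)
Lemma quadratic_rate (R : realType) (p : R) : 0 <= p -> p <= 1 / 8 ->
  p * (1 + (p + 4 * p ^+ 2)) ^+ 2 <= p + 4 * p ^+ 2.
Proof.
move=> p_ge0 p_le.
have p2 : p ^+ 2 <= p / 8 by have := ler_wpM2l p_ge0 p_le; rewrite -expr2; lra.
rewrite [X in _ <= X](_ : _ = p * (1 + 4 * p)); last by ring.
apply: ler_wpM2l => //; set t := p + 4 * p ^+ 2.
have t_ge0 : 0 <= t by rewrite addr_ge0 // mulr_ge0 // sqr_ge0.
have t_le : t <= 3 / 2 * p by rewrite /t; lra.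
have t_le1 : t <= 3 / 16 by lra.
have t2 : t ^+ 2 <= 3 / 16 * t by rewrite expr2; apply: ler_wpM2r.
rewrite (_ : (1 + t) ^+ 2 = 1 + 2 * t + t ^+ 2); last by ring.
move: t t_ge0 t_le t_le1 t2 => t *; lra.
Qed.

(** Points at positions [x / M] and [y / M] of two neighbouring cells are
    [(M + y - x) / M] cell lengths apart.  The strict inequality absorbs the
    error of one unit made by truncating the positions. *)
Definition good_pair (S M : nat) : rel 'I_M := fun x y => (S + x < M + y)%N.

(** Proportion of bad pairs among the [M^2] pairs; it is close to half the square
    of [S / M]. *)
Definition bad_rate (R : realType) (S M : nat) : R :=
  (S * S.+1)%:R / (2 * M%:R ^+ 2).

(** The fraction of words of length [N] over [M] letters without bad pair is
    [exp (- N p)] up to lower order terms, [p] being the proportion of bad pairs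
    among all pairs. *)
Lemma admissible_fraction (R : realType) (S M N : nat) (p := bad_rate R S M) :
  (0 < N)%N -> (2 * S.+1 <= M)%N ->
  expR (- (N.-1%:R * (p + 4 * p ^+ 2)))
    <= #|[set t : N.-tuple 'I_M | sorted (@good_pair S M) t]%SET|%:R / M%:R ^+ N
    <= expR (- (N.-1%:R * p)).
Proof.
move=> N0 SM.
pose F n := #|[set t : n.-tuple 'I_M | sorted (@good_pair S M) t]%SET|.
rewrite -/(F N); pose q n : R := (F n)%:R / M%:R ^+ n.
rewrite -/(q N) -[X in q X](prednK N0); rewrite {}/p /bad_rate; set p : R := _ / _.
have M0 : (0 : R) < M%:R by rewrite ltr0n; lia.
have p_ge0 : 0 <= p by rewrite /p divr_ge0 // mulr_ge0 // exprn_ge0 // ltW.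
have p_le : p <= 1 / 8.
  rewrite /p ler_pdivrMr ?mulr_gt0 ?exprn_gt0 //.
  have : ((4 * (S * S.+1))%:R : R) <= (M ^ 2)%:R by rewrite ler_nat; nia.
  by rewrite natrM natrX; lra.
have q0 : q 0 = 1.
  rewrite /q /F expr0 divr1 (_ : [set _ | _]%SET = [set: 0.-tuple 'I_M]%SET).
    by rewrite cardsT card_tuple expn0.
  by apply/setP => t; rewrite !inE tuple0.
have q1 : q 1 = 1.
  rewrite /q /F expr1 (_ : [set _ | _]%SET = [set: 1.-tuple 'I_M]%SET).
    by rewrite cardsT card_tuple expn1 card_ord divff ?gt_eqF.
  by apply/setP => t; rewrite !inE; case: t => [[|? []]].
have qSS n : q n.+2 = q n.+1 - p * q n.
  have nbad (x y z : 'I_M) : ~~ good_pair S x y -> good_pair S y z.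
    by rewrite /good_pair; have := ltn_ord x; lia.
  have := congr1 (fun k : nat => (2 * k)%:R : R) (card_sortedSS n nbad).
  rewrite -/(F n.+2) -/(F n.+1) -/(F n) mulnDr mulnA card_bad; last by lia.
  rewrite card_ord !(natrD, natrM) /q /p => eqF.
  have eqF' : (F n.+2)%:R = M%:R * (F n.+1)%:R - S%:R * S.+1%:R * (F n)%:R / 2 :> R.
    by lra.
  rewrite eqF' natrM !exprS; field.
  by rewrite expf_neq0 ?gt_eqF.
have rate := quadratic_rate p_ge0 p_le.
have rate_ge0 : 0 <= p + 4 * p ^+ 2 by rewrite addr_ge0 // mulr_ge0 // sqr_ge0.
rewrite (recurrence_ge p_ge0 rate_ge0 rate q0 q1 qSS).
exact: recurrence_le p_ge0 rate_ge0 rate q0 q1 qSS _.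
Qed.

(** * Separation and covering radius of a finite sequence *)

Section Separation.
Variable R : realType.
Implicit Type s : seq R.

Let has_lbound_gaps s : has_lbound [set `|s`_ij.1 - s`_ij.2| |
  ij in [set ij : nat * nat | (ij.1 < ij.2 < size s)%N]].
Proof. by exists 0 => _ [ij _ <-]; rewrite normr_ge0. Qed.

Lemma R_infty_le s i j : (i < size s)%N -> (j < size s)%N -> i != j ->
  R_infty s <= `|s`_i - s`_j|.
Proof.
move=> si sj; rewrite neq_ltn => /orP[ij|ji].
  by apply: ge_inf => //; exists (i, j) => //=; rewrite ij.
by rewrite distrC; apply: ge_inf => //; exists (j, i) => //=; rewrite ji.
Qed.

Lemma le_R_infty s r : (1 < size s)%N ->
  (forall i j, (i < j < size s)%N -> r <= `|s`_i - s`_j|) -> r <= R_infty s.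
Proof.
move=> s1 hr; apply: lb_le_inf; first by exists `|s`_0 - s`_1|, (0, 1).
by move=> _ [[i j] /= ij <-]; exact: hr.
Qed.

Lemma R_infty_ge0 s : 0 <= R_infty s.
Proof.
rewrite /R_infty; set E := (X in inf X); have [->|/set0P E0] := eqVneq E set0.
  by rewrite inf0.
by apply: lb_le_inf => // _ [ij _ <-].
Qed.

Lemma R_infty_mkseq_le (f : nat -> R) m n : (1 < m <= n)%N ->
  R_infty (mkseq f n) <= R_infty (mkseq f m).
Proof.
case/andP=> m1 mn; apply: le_R_infty; rewrite size_mkseq // => i j /andP[ij jm].
have -> : (mkseq f m)`_i = (mkseq f n)`_i by rewrite !nth_mkseq //; lia.
have -> : (mkseq f m)`_j = (mkseq f n)`_j by rewrite !nth_mkseq //; lia.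
by apply: R_infty_le; rewrite ?size_mkseq; lia.
Qed.

(** With a smaller covering radius, two of the [n + 1] equally spaced points
    [k / n] of the unit interval would be closer than [1 / (2 n)] to the same
    point of [s], hence closer than [1 / n] to each other. *)
Lemma h_infty_ge s : (0 < size s)%N -> (2 * (size s)%:R)^-1 <= h_infty s.
Proof.
set n := size s => n0; rewrite leNgt; apply/negP => hn.
have nR : (0 : R) < n%:R by rewrite ltr0n.
pose D (z : R) : set R := [set `|z - y| | y in [set` s]].
have D0 z : D z !=set0.
  by exists `|z - s`_0|, s`_0 => //=; rewrite mem_nth.
have lbD z : has_lbound (D z).
  by exists 0 => _ [y _ <-].
have near (k : 'I_n.+1) :
    exists i : 'I_n, `|k%:R / n%:R - s`_i| < (2 * n%:R)^-1.
  have kn : k%:R / n%:R \in `[0 : R, 1].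
    by rewrite in_itv /= divr_ge0 //= ler_pdivrMr // mul1r ler_nat -ltnS.
  have : inf (D (k%:R / n%:R)) < (2 * n%:R)^-1.
    apply: le_lt_trans hn; apply: ub_le_sup; last by exists (k%:R / n%:R).
    exists (1 + `|s`_0|) => _ [z /= z01 <-].
    apply: (@le_trans _ _ `|z - s`_0|).
      apply: ge_inf; first exact: lbD.
      by exists s`_0 => //; exact: mem_nth.
    apply: (le_trans (ler_normB _ _)); rewrite lerD2r.
    by move: z01; rewrite in_itv /= => /andP[z0 z1]; rewrite ger0_norm.
  move=> /(inf_lt (D0 _))[_ [y /= ys <-]] yk.
  have si : (index y s < n)%N by rewrite index_mem.
  by exists (Ordinal si) => //=; rewrite nth_index.
have [f fP] := boolp.choice near.
have : ~~ injectiveb f.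
  apply/injectiveP => /leq_card; rewrite !card_ord; lia.
case/injectivePn => k [l kl fkl].
have : `|k%:R / n%:R - l%:R / n%:R| < n%:R^-1 :> R.
  rewrite -[X in `|X|](subrKA (s`_(f k))) [X in _ < X](_ : _ = (2 * n%:R)^-1 + (2 * n%:R)^-1).
    apply: le_lt_trans (ler_normD _ _) _; rewrite ltrD //.
    by rewrite fkl distrC.
  by field; rewrite gt_eqF.
rewrite -mulrBl normrM [`|_^-1|]ger0_norm ?invr_ge0 ?ltW //.
rewrite -[ltRHS]mul1r ltr_pM2r ?invr_gt0 //.
rewrite ltNge => /negP; apply.
have : (k : nat) != l by [].
rewrite neq_ltn => /orP[|] lt; [rewrite distrC|]; rewrite -natrB ?(ltnW lt) //;
by rewrite normr_nat ler1n subn_gt0.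
Qed.

End Separation.

(** * Separation of the scrambled points *)

Section ScrambledGap.
Variables (R : realType) (b m K S : nat) (a : nat -> nat -> 'I_b).
Variable p : seq 'I_b -> {perm 'I_b}.
Hypothesis a_inj : forall j j', (j < b ^ m)%N -> (j' < b ^ m)%N ->
  (forall r, (r < m)%N -> a j r = a j' r) -> j = j'.

Let N := (b ^ m)%N.
Let M := (b ^ K)%N.
Let pos (j : nat) : nat := (cell m a p j * M + subcell m K a p j)%N.
Let y (j : nat) : R := digits_value R (scramble_digits p (a j)).

Let NM_gt0 : (0 : R) < (N * M)%:R.
Proof.
have b0 : (0 < b)%N by exact: leq_ltn_trans (ltn_ord (a 0 0)).
by rewrite ltr0n muln_gt0 !expn_gt0 b0.
Qed.

Let y_itv j : (pos j)%:R / (N * M)%:R <= y j <= (pos j).+1%:R / (N * M)%:R.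
Proof.
rewrite /pos /N /M /= -digits_nat_cat -expnD natrX.
by rewrite digits_value_ge digits_value_le.
Qed.

Let subcellE (j : 'I_(b ^ m)) :
  subcell m K a p j = tnth (subcells m K a p) (cell m a p j).
Proof. by rewrite tnth_mktuple cellK. Qed.

Let pos_lt (i j : 'I_(b ^ m)) : (S <= M)%N ->
  sorted (@good_pair S M) (subcells m K a p) ->
  (cell m a p i < cell m a p j)%N -> (S + (pos i).+1 <= pos j)%N.
Proof.
move=> SM /sortedP good; rewrite /pos => cij.
have [ilt jlt] := (ltn_ord (subcell m K a p i), ltn_ord (subcell m K a p j)).
rewrite -/M in ilt jlt.
have [cj|cj] := eqVneq (cell m a p j : nat) (cell m a p i).+1.
  have := good (subcell m K a p i) (cell m a p i).
  rewrite size_tuple -cj -!tnth_nth -!subcellE /good_pair => /(_ (ltn_ord _)).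
  rewrite cj -/M mulSn; move: (_ * M)%N (val _) (val _) => c si sj.
  by lia.
have cj2 : ((cell m a p i).+2 <= cell m a p j)%N by rewrite ltn_neqAle eq_sym cj.
have := leq_mul cj2 (leqnn M); rewrite !mulSn.
have aux u v si sj L : (si < L)%N -> (S <= L)%N -> (L + (L + u) <= v)%N ->
    (S + (u + si).+1 <= v + sj)%N by lia.
exact: aux ilt SM.
Qed.

(** Points in cells that are not neighbours are at least a whole cell apart, so
    only neighbouring cells matter. *)
Lemma R_infty_scrambled_ge : (1 < N)%N -> (S <= M)%N ->
  sorted (@good_pair S M) (subcells m K a p) ->
  S%:R / (N * M)%:R <= R_infty (scrambled_points R p a N).
Proof.
move=> N_gt1 SM good; apply: le_R_infty; rewrite size_mkseq // => i j /andP[ij jN].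
have iN := ltn_trans ij jN; rewrite !nth_mkseq // -/(y i) -/(y j).
have gap (k l : 'I_(b ^ m)) : (cell m a p k < cell m a p l)%N ->
    S%:R / (N * M)%:R <= y l - y k.
  move=> /(pos_lt SM good); rewrite -(ler_nat R) natrD => kl.
  have [/andP[_ yk] /andP[yl _]] := (y_itv k, y_itv l).
  apply: le_trans (lerB yl yk); rewrite -mulrBl ler_pM2r ?invr_gt0 //.
  by rewrite lerBrDr.
have : cell m a p i != cell m a p j.
  apply/negP => /eqP /(cell_inj a_inj (x1 := Ordinal iN) (x2 := Ordinal jN)).
  by move=> /(congr1 val) /= eij; rewrite eij ltnn in ij.
rewrite -val_eqE neq_ltn => /orP[] c.
  by rewrite distrC; apply: le_trans (ler_norm _); exact: (gap (Ordinal iN) (Ordinal jN)).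
by apply: le_trans (ler_norm _); exact: (gap (Ordinal jN) (Ordinal iN)).
Qed.

Lemma R_infty_scrambled_le :
  ~~ sorted (@good_pair S M) (subcells m K a p) ->
  R_infty (scrambled_points R p a N) <= S.+1%:R / (N * M)%:R.
Proof.
move=> bad.
have [c [c' [c'E cbad]]] : exists c c' : 'I_(b ^ m), c' = c.+1 :> nat /\
    ~~ good_pair S (tnth (subcells m K a p) c) (tnth (subcells m K a p) c').
  apply: contraNP bad => nbad; apply/(sortedP (subcell m K a p 0)) => c.
  rewrite size_tuple => cN; apply: contraT => cbad; case: nbad.
  exists (Ordinal (ltnW cN)), (Ordinal cN); split=> //; apply: contra cbad.
  by rewrite !(tnth_nth (subcell m K a p 0)).
pose i := point_in_cell a p c; pose j := point_in_cell a p c'.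
have ci : cell m a p i = c by exact: point_in_cellK.
have cj : cell m a p j = c' by exact: point_in_cellK.
move: cbad; rewrite -ci -cj -!subcellE /good_pair -leqNgt => ijbad.
have ij : i != j.
  apply/eqP => eij; move: ci; rewrite eij cj => c'c.
  by move: c'E; rewrite c'c => /n_Sn.
have := @R_infty_le _ (scrambled_points R p a N) i j.
rewrite size_mkseq => /(_ (ltn_ord _) (ltn_ord _) ij); rewrite !nth_mkseq //.
move/le_trans; apply; rewrite -/(y i) -/(y j) distrC.
have ilt := ltn_ord (subcell m K a p i); rewrite -/M in ilt.
have pij : (pos j = pos i - subcell m K a p i + M + subcell m K a p j)%N.
  by rewrite /pos ci cj c'E addnK mulSn [(M + _)%N]addnC.
have posi : (subcell m K a p i <= pos i)%N by rewrite /pos leq_addl.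
have [/andP[yi yi'] /andP[yj yj']] := (y_itv i, y_itv j).
rewrite ger0_norm.
  apply: le_trans (lerB yj' yi) _; rewrite -mulrBl ler_pM2r ?invr_gt0 //.
  by rewrite lerBlDr -natrD ler_nat pij; lia.
rewrite subr_ge0; apply: le_trans yi' _; apply: le_trans yj.
rewrite ler_pM2r ?invr_gt0 // ler_nat pij.
have aux q si sj L : (si < L)%N -> (si <= q)%N -> (q < q - si + L + sj)%N by lia.
exact: aux.
Qed.

End ScrambledGap.

(** * The law of the separation radius *)

Section ScrambledLaw.
Context d (T : measurableType d) (R : realType) (P : probability T R).
Variables (b : nat) (a : nat -> nat -> 'I_b) (pi : seq 'I_b -> T -> {perm 'I_b}).
Hypothesis hpi : owen_permutations P pi.
Hypothesis a_inj : forall m j j', (j < b ^ m)%N -> (j' < b ^ m)%N ->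
  (forall r, (r < m)%N -> a j r = a j' r) -> j = j'.

Let Rad n w : R := R_infty (scrambled_points R (pi^~ w) a n).

Lemma measurable_scrambled_point j :
  measurable_fun setT (fun w => digits_value R (scramble_digits (pi^~ w) (a j))).
Proof.
pose h L w : R := (digits_nat (scramble_digits (pi^~ w) (a j)) L)%:R / b%:R ^+ L.
apply: (@measurable_fun_cvg _ _ _ _ h) => [L _ B mB|w _].
  rewrite setTI; apply: (measurable_finitary (s := mkseq (fun r => mkseq (a j) r) L)
    (Q := fun f => B ((digits_nat (scramble_digits f (a j)) L)%:R / b%:R ^+ L))).
    exact: hpi.1.
  move=> f g fg; rewrite (@eq_digits_nat _ _ (scramble_digits g (a j))) // => r rL.
  rewrite /scramble_digits fg //.
  by apply/mapP; exists r; rewrite ?mem_iota.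
rewrite (_ : h^~ w = series (fun r =>
    (scramble_digits (pi^~ w) (a j) r : nat)%:R / (b%:R : R) ^+ r.+1)).
  exact: is_cvg_series_digits.
by apply/funext => L; rewrite series_digits.
Qed.

Lemma measurable_R_infty_scrambled n : measurable_fun setT (Rad n).
Proof.
have [n1|n1] := leqP n 1.
  rewrite (_ : Rad n = cst 0); first exact: measurable_cst.
  apply/funext => w; rewrite /Rad /R_infty (_ : [set _ | _ in _] = set0) ?inf0 //.
  by rewrite -subset0 => t [[i j] /=]; rewrite size_mkseq; lia.
move=> _; apply: (measurability _ (RGenCInfty.measurableE R)) => //.
move=> _ [_ [r ->] <-]; rewrite setTI.
pose y j w := digits_value R (scramble_digits (pi^~ w) (a j)).
rewrite (_ : _ @^-1` _ = \bigcap_(j in [set j | (j < n)%N])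
    \bigcap_(i in [set i | (i < j)%N]) [set w | r <= `|y i w - y j w|]).
  apply: bigcap_measurableType => j _; apply: bigcap_measurableType => i _.
  rewrite -[X in measurable X]setTI.
  have mgap : measurable_fun setT (fun w => r <= `|y i w - y j w|).
    apply: measurable_fun_ler; first exact: measurable_cst.
    by apply: measurableT_comp => //; apply: measurable_funB;
       exact: measurable_scrambled_point.
  exact: (mgap measurableT [set true]).
apply/seteqP; split=> w /=; rewrite in_itv /= andbT => rw.
  move=> j /= jn i ij; apply: le_trans rw _; have in' := ltn_trans ij jn.
  rewrite /Rad; have := @R_infty_le _ (scrambled_points R (pi^~ w) a n) i j.
  by rewrite size_mkseq !nth_mkseq //; apply; rewrite ?ltn_eqF.
apply: le_R_infty; rewrite size_mkseq // => i j /andP[ij jn].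
rewrite !nth_mkseq ?(ltn_trans ij) //; exact: (rw j jn i ij).
Qed.

Lemma measurable_R_infty_gt n r : measurable [set w | r < Rad n w].
Proof.
rewrite -[X in measurable X]setTI; have := measurable_R_infty_scrambled n.
move=> /(_ measurableT `]r, +oo[%classic (measurable_itv _)).
by congr (measurable _); apply/seteqP; split=> w /=; rewrite in_itv /= andbT.
Qed.

Lemma prob_admissible m K S :
  let E := [set w | sorted (@good_pair S (b ^ K)) (subcells m K a (pi^~ w))] in
  measurable E /\
  P E = (#|[set t : (b ^ m).-tuple 'I_(b ^ K) |
            sorted (@good_pair S (b ^ K)) t]%SET|%:R
         / (b ^ K)%:R ^+ (b ^ m))%:E.
Proof.
move=> E; pose Y w := subcells m K a (pi^~ w).
have slice v : measurable (E `&` [set w | Y w = v]) /\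
    P (E `&` [set w | Y w = v]) = if sorted (@good_pair S (b ^ K)) v
      then ((b ^ K)%:R ^- (b ^ m))%:E else 0%E.
  have [mv Pv] := prob_subcells (@a_inj m) hpi v.
  case: ifPn => sv.
    rewrite (_ : _ `&` _ = [set w | subcells m K a (pi^~ w) = v]) //.
    apply/seteqP; split=> [w [_ Yv] //|w Yv]; split=> //.
    by change (is_true (sorted (@good_pair S (b ^ K)) (Y w))); rewrite [Y w]Yv.
  rewrite (_ : _ `&` _ = set0) ?measure0 //; apply/seteqP; split=> w // [sw Yv].
  by case/negP: sv; rewrite -Yv.
have [mE ->] := measure_partition P (fun v => (slice v).1).
split=> //; under eq_bigr => v _ do rewrite (slice v).2.
rewrite -big_mkcond sumEFin sumr_const cardsE /=.
by rewrite mulr_natl.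
Qed.

(** Positions are truncated after [K = m] digits: the separation radius is then
    known up to [b^(-2m)], which is small compared with its order of magnitude
    [b^(-3m/2)]. *)
Section Bounds.
Variables (m S : nat).
Hypothesis S_le : (2 * S.+1 <= b ^ m)%N.
Let N : R := (b ^ m)%:R.
Let p : R := bad_rate R S (b ^ m).

Let frac_bounds := admissible_fraction R (N := b ^ m) (leq_trans (ltn0Sn _) S_le) S_le.

Let N_gt1 : (1 < b ^ m)%N.
Proof. by apply: leq_trans S_le; lia. Qed.

Lemma prob_R_infty_gt :
  (P [set w | (S.+1%:R / N ^+ 2 < Rad (b ^ m) w)%R]
    <= (expR (- ((b ^ m).-1%:R * p)))%:E)%E.
Proof.
have [mE PE] := prob_admissible m m S.
apply: le_trans (_ : P [set w | sorted (@good_pair S (b ^ m))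
    (subcells m m a (pi^~ w))] <= _)%E.
  apply: le_measure; rewrite ?inE //; first exact: measurable_R_infty_gt.
  move=> w /=; rewrite ltNge; apply: contraNT => bad.
  by rewrite expr2 -natrM; exact: R_infty_scrambled_le (@a_inj m) bad.
by rewrite PE lee_fin; have /andP[] := frac_bounds.
Qed.

Lemma prob_R_infty_ge (r : R) : r < S%:R / N ^+ 2 ->
  ((expR (- ((b ^ m).-1%:R * (p + 4 * p ^+ 2))))%:E
    <= P [set w | (r < Rad (b ^ m) w)%R])%E.
Proof.
move=> rS; have [mE PE] := prob_admissible m m S.
apply: le_trans (_ : _ <= P [set w | sorted (@good_pair S (b ^ m))
    (subcells m m a (pi^~ w))])%E _.
  by rewrite PE lee_fin; have /andP[] := frac_bounds.
apply: le_measure; rewrite ?inE //; first exact: measurable_R_infty_gt.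
move=> w good /=; apply: lt_le_trans rS _.
rewrite expr2 -natrM; apply: R_infty_scrambled_ge (@a_inj m) N_gt1 _ good.
by move: S_le; lia.
Qed.

End Bounds.
End ScrambledLaw.

(** * The limit law *)

(** When [S] is [t s] up to a bounded error and [M = s^2], the proportion of bad
    pairs is [t^2 / (2 M)] up to lower order terms; the two lemmas below give
    explicit bounds that are polynomial in [t] and [1 / s]. *)
Lemma bad_rate_le (R : realType) (t s : R) (S M : nat) : 0 <= t -> 0 < s ->
  M%:R = s ^+ 2 -> S%:R <= t * s + 1 ->
  bad_rate R S M <= (t + s^-1) * (t + 2 / s) / 2 / s ^+ 2.
Proof.
move=> t0 s0 Ms Sts; rewrite /bad_rate Ms natrM -[S.+1%:R]natr1.
have -> : (t + s^-1) * (t + 2 / s) / 2 / s ^+ 2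
    = (t * s + 1) * (t * s + 2) / (2 * (s ^+ 2) ^+ 2).
  by field; rewrite gt_eqF.
rewrite ler_pM2r ?invr_gt0 ?mulr_gt0 ?exprn_gt0 // ler_pM ?addr_ge0 //; lra.
Qed.

Lemma bad_rate_ge (R : realType) (t s : R) (S M : nat) : 0 <= t -> 0 < s ->
  M%:R = s ^+ 2 -> t * s <= S%:R + 2 ->
  (t ^+ 2 - 4 * t / s) / 2 / s ^+ 2 <= bad_rate R S M.
Proof.
move=> t0 s0 Ms Sts; rewrite /bad_rate Ms natrM -[S.+1%:R]natr1.
have -> : (t ^+ 2 - 4 * t / s) / 2 / s ^+ 2
    = ((t * s) ^+ 2 - 4 * (t * s)) / (2 * (s ^+ 2) ^+ 2).
  by field; rewrite gt_eqF.
rewrite ler_pM2r ?invr_gt0 ?mulr_gt0 ?exprn_gt0 //.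
have S0 : 0 <= S%:R :> R by [].
have := mulr_ge0 t0 (ltW s0); move: (t * s) (S%:R : R) Sts S0 => u v uv v0 u0.
have [u4|u4] := lerP u 4.
  apply: (@le_trans _ _ 0); last by nra.
  by rewrite expr2 -mulrBl mulr_le0_ge0 // subr_le0.
apply: (@le_trans _ _ ((u - 2) ^+ 2)); first by nra.
rewrite expr2 ler_pM //; lra.
Qed.

Lemma threshold_le_square (R : realType) (t u v : R) :
  0 <= t -> u <= t * v -> 2 * t + 4 <= v -> 2 * (u + 1 + 1) <= v ^+ 2.
Proof.
move=> t0 utv tv; apply: (@le_trans _ _ ((2 * t + 4) * v)); first by lra.
by rewrite expr2 ler_wpM2r //; lra.
Qed.

Section LimitLaw.
Context d (T : measurableType d) (R : realType) (P : probability T R).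
Variables (b : nat) (a : nat -> nat -> 'I_b) (pi : seq 'I_b -> T -> {perm 'I_b}).
Hypothesis b_gt1 : (1 < b)%N.
Hypothesis hpi : owen_permutations P pi.
Hypothesis a_inj : forall m j j', (j < b ^ m)%N -> (j' < b ^ m)%N ->
  (forall r, (r < m)%N -> a j r = a j' r) -> j = j'.

Let Rad n w : R := R_infty (scrambled_points R (pi^~ w) a n).
Let s m : R := Num.sqrt b%:R ^+ m.
Let x m : R := (s m)^-1.

Let s_gt0 m : 0 < s m.
Proof. by rewrite exprn_gt0 // sqrtr_gt0 ltr0n ltnW. Qed.

Let N_s m : (b ^ m)%:R = s m ^+ 2 :> R.
Proof. by rewrite natrX /s exprAC sqr_sqrtr. Qed.

Let cvg_x : x @ \oo --> (0 : R).
Proof.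
have -> : x = GRing.exp (Num.sqrt b%:R)^-1.
  by apply/funext => m; rewrite /x /s exprVn.
apply: cvg_expr; rewrite ger0_norm ?invr_ge0 // invf_lt1 ?sqrtr_gt0 ?ltr0n 1?ltnW //.
by rewrite -[ltLHS]sqrtr1 ltr_sqrt ?ltr1n // ltr0n ltnW.
Qed.

Let div_cube t m : t / s m ^+ 3 = t * s m / (s m ^+ 2) ^+ 2.
Proof.
have : s m != 0 by rewrite gt_eqF.
by move: (s m) => v v0; field.
Qed.

Section Threshold.
Variable t : R.
Hypothesis t_ge0 : 0 <= t.

Let A m : R := (t + x m) * (t + 2 * x m) / 2.
Let low m : R := expR (- (A m + 4 * A m ^+ 2 * x m ^+ 2)).
Let high m : R := expR (- ((1 - x m ^+ 2) * ((t ^+ 2 - 4 * t * x m) / 2))).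
Let prob m := P [set w | (t < s m ^+ 3 * Rad (b ^ m) w)%R].

Let event m : [set w | (t < s m ^+ 3 * Rad (b ^ m) w)%R]
            = [set w | (t / s m ^+ 3 < Rad (b ^ m) w)%R].
Proof.
have s3_gt0 : 0 < s m ^+ 3 by rewrite exprn_gt0.
by apply/seteqP; split=> w /=; rewrite ltr_pdivrMr // [_ * s m ^+ 3]mulrC.
Qed.

Let prob_itv m : 2 * t + 4 <= s m ->
  ((low m)%:E <= prob m <= (high m)%:E)%E.
Proof.
move=> st; rewrite /prob event.
have N2_gt0 : 0 < (s m ^+ 2) ^+ 2 by do 2![apply: exprn_gt0]; exact: s_gt0.
have ts_ge0 : 0 <= t * s m by rewrite mulr_ge0 // ltW.
(* With [N = s^2] points, [t s^-3 = t s / N^2] lies between [S / N^2] and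
   [S.+1 / N^2]. *)
pose S := Num.truncn (t * s m); have /andP[S_le lt_S] := truncn_itv ts_ge0.
rewrite -/S in S_le lt_S.
have N_ge1 : 1 <= (b ^ m)%:R :> R by rewrite ler1n expn_gt0 ltnW.
have NB1 : (b ^ m).-1%:R = s m ^+ 2 - 1 :> R.
  by rewrite -N_s -subn1 natrB // -(ler1n R).
have S_small : (2 * S.+2 <= b ^ m)%N.
  rewrite -(ler_nat R) N_s natrM -[S.+2%:R]natr1 -[S.+1%:R]natr1.
  exact: threshold_le_square t_ge0 S_le st.
apply/andP; split.
  apply: le_trans (prob_R_infty_ge hpi a_inj S_small _); last first.
    by rewrite N_s div_cube ltr_pM2r ?invr_gt0 //.
  rewrite lee_fin ler_expR lerN2 NB1.
  have := @bad_rate_le _ t (s m) S.+1 (b ^ m) t_ge0 (s_gt0 m) (N_s m).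
  rewrite -natr1 lerD2r => /(_ S_le); rewrite -/(x m) -/(A m).
  set p := bad_rate _ _ _ => p_le.
  have p_ge0 : 0 <= p by rewrite /p /bad_rate divr_ge0 // mulr_ge0 // exprn_ge0.
  have Ns : 0 < s m ^+ 2 by rewrite exprn_gt0.
  have -> : A m + 4 * A m ^+ 2 * x m ^+ 2
      = s m ^+ 2 * (A m / s m ^+ 2 + 4 * (A m / s m ^+ 2) ^+ 2).
    by rewrite /x; move: (A m) => c; field; rewrite gt_eqF.
  apply: ler_pM; [by rewrite subr_ge0 -N_s| | |].
  - by rewrite addr_ge0 // mulr_ge0 // sqr_ge0.
  - by rewrite gerBl.
  - rewrite lerD // ler_wpM2l // lerXn2r ?nnegrE //.
    exact: le_trans p_ge0 p_le.
have x2 : 0 <= 1 - x m ^+ 2.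
  by rewrite subr_ge0 /x exprVn invf_le1 -?N_s // (lt_le_trans ltr01).
have : expR (- ((b ^ m).-1%:R * bad_rate R S.-1 (b ^ m))) <= high m.
  rewrite ler_expR lerN2 NB1.
  have := @bad_rate_ge _ t (s m) S.-1 (b ^ m) t_ge0 (s_gt0 m) (N_s m).
  have S1 : S.+1%:R <= S.-1%:R + 2 :> R.
    by rewrite -[2]/(2%:R) -natrD ler_nat; lia.
  move=> /(_ (ltW (lt_le_trans lt_S S1))); rewrite -/(x m) => p_ge.
  rewrite (_ : 1 - x m ^+ 2 = (s m ^+ 2 - 1) / s m ^+ 2); last first.
    by rewrite /x; field; rewrite gt_eqF.
  rewrite -[leLHS]mulrA ler_wpM2l ?subr_ge0 -?N_s // [leLHS]mulrC N_s.
  exact: p_ge.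
rewrite -lee_fin; apply: le_trans.
(* For [S = 0] the upper bound is trivial; otherwise [S.-1.+1 = S]. *)
have [S0|S_gt0] := posnP S.
  rewrite S0 /bad_rate /= mul0n mul0r mulr0 oppr0 expR0.
  exact: probability_le1 (measurable_R_infty_gt a hpi _ _).
have S_small' : (2 * S.-1.+1 <= b ^ m)%N by move: S_small; lia.
apply: le_trans (prob_R_infty_gt hpi a_inj S_small').
apply: le_measure; rewrite ?inE.
- exact: (measurable_R_infty_gt a hpi (b ^ m) (t / s m ^+ 3)).
- exact: (measurable_R_infty_gt a hpi (b ^ m) (S.-1.+1%:R / (b ^ m)%:R ^+ 2)).
move=> w /=; apply: le_lt_trans; rewrite prednK // N_s div_cube.
by rewrite ler_pM2r ?invr_gt0 //.
Qed.

(** Survival function of the scaled separation radius; [s m ^+ 3] is [N^(3/2)]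
    for [N = b^m] points. *)
Lemma cvg_scaled_R_infty :
  P [set w | (t < s m ^+ 3 * Rad (b ^ m) w)%R] @[m --> \oo]
    --> (expR (- (t ^+ 2 / 2)))%:E.
Proof.
have cA : A @ \oo --> (t + 0) * (t + 2 * 0) / 2.
  by apply: cvgMl; apply: cvgM; apply: cvgD; [exact: cvg_cst|exact: cvg_x|
    exact: cvg_cst|apply: cvgM; [exact: cvg_cst|exact: cvg_x]].
have clow : low @ \oo --> expR (- (t ^+ 2 / 2)).
  apply: continuous_cvg; first exact: continuous_expR.
  apply: cvgN; rewrite (_ : t ^+ 2 / 2 = (t + 0) * (t + 2 * 0) / 2 +
    4 * ((t + 0) * (t + 2 * 0) / 2) ^+ 2 * 0 ^+ 2); last by field.
  apply: cvgD => //; apply: cvgM; last by rewrite !expr2; apply: cvgM; exact: cvg_x.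
  by apply: cvgM; [exact: cvg_cst|rewrite !expr2; apply: cvgM].
have chigh : high @ \oo --> expR (- (t ^+ 2 / 2)).
  apply: continuous_cvg; first exact: continuous_expR.
  apply: cvgN; rewrite (_ : t ^+ 2 / 2 =
    (1 - 0 ^+ 2) * ((t ^+ 2 - 4 * t * 0) / 2)); last by field.
  apply: cvgM.
    apply: cvgB; first exact: cvg_cst.
    by rewrite !expr2; apply: cvgM; exact: cvg_x.
  apply: cvgMl; apply: cvgB; first exact: cvg_cst.
  by apply: cvgM; [exact: cvg_cst|exact: cvg_x].
apply: (@squeeze_cvge _ _ _ _ (EFin \o low) _ (EFin \o high)).
- have t4_gt0 : 0 < 2 * t + 4 by rewrite ltr_wpDl // mulr_ge0.
  have e0 : 0 < (2 * t + 4)^-1 by rewrite invr_gt0.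
  near=> m; apply: prob_itv.
  rewrite -[leRHS]invrK -/(x m) -[leLHS]invrK lef_pV2 ?posrE ?invr_gt0 //.
  rewrite ltW //; near: m; have /cvgr0Pnorm_lt /(_ _ e0) := cvg_x.
  by apply: filterS => m; apply: le_lt_trans; exact: ler_norm.
- by apply: cvg_EFin; [exact: nearW|exact: clow].
- by apply: cvg_EFin; [exact: nearW|exact: chigh].
Unshelve. all: by end_near. Qed.

End Threshold.
End LimitLaw.

Lemma cdf_weibull (R : realType) d (T : measurableType d)
    (P : probability T R) (W : {RV P >-> R}) (t : R) : is_weibull W 2 (1 / 2) ->
  cdf W t = (if 0 <= t then 1 - expR (- (t ^+ 2 / 2)) else 0)%:E.
Proof.
move=> hW.
have cdfE u : 0 <= u -> cdf W u = (1 - expR (- (u ^+ 2 / 2)))%:E.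
  move=> u0; rewrite cdf_1_ccdf hW // (powR_mulrn 2) //.
  by rewrite EFinB mul1r mulrC.
case: ifPn => [|]; first exact: cdfE.
rewrite -ltNge => t0; apply/eqP; rewrite eq_le; apply/andP; split; last exact: cdf_ge0.
apply: le_trans (cdf_nondecreasing W (ltW t0)) _.
by rewrite cdfE // expr0n /= mul0r oppr0 expR0 subrr.
Qed.

Lemma powR_mul3_half (R : realType) (b m : nat) :
  b%:R `^ (3 * m%:R / 2) = (Num.sqrt b%:R ^+ m) ^+ 3 :> R.
Proof.
rewrite -powR12_sqrt // (_ : 3 * m%:R / 2 = 2^-1 * (m * 3)%:R); last first.
  by rewrite natrM; field.
by rewrite powRrM powR_mulrn ?powR_ge0 // exprM.
Qed.

(** * Almost sure bounds *)

(** Borel-Cantelli for events with geometrically decaying probabilities. *)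
Lemma ae_eventually_not (R : realType) d (T : measurableType d)
    (P : probability T R) (F : (set T)^nat) (z : R) : 0 <= z < 1 ->
  (forall n, measurable (F n)) -> (forall n, P (F n) <= (z ^+ n)%:E)%E ->
  {ae P, forall w, exists n, forall k, (n <= k)%N -> ~ F k w}.
Proof.
move=> /andP[z0 z1] mF PF.
have : P (lim_sup_set F) = 0%E.
  apply: lim_sup_set_cvg0 => //.
  apply: (@le_lt_trans _ _ ((1 - z)^-1)%:E); last exact: ltry.
  apply: lime_le; first by apply: is_cvg_nneseries.
  apply: nearW => n; apply: (@le_trans _ _ (\sum_(0 <= k < n) (z ^+ k)%:E)%E).
    by apply: lee_sum => k _; exact: PF.
  rewrite sumEFin lee_fin.
  have := geometric_seriesE 1 (negbT (lt_eqF z1)).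
  move=> /(congr1 (fun u : R^nat => u n)); rewrite /series /geometric /=.
  under eq_bigr do rewrite mul1r.
  move=> ->; rewrite ler_pdivrMr ?subr_gt0 // mulVf ?gt_eqF ?subr_gt0 //.
  by rewrite mul1r gerBl exprn_ge0.
move=> P0; exists (lim_sup_set F); split=> //.
  apply: bigcap_measurable; first by exists 0%N.
  by move=> n _; exact: bigcup_measurable.
move=> w /= nw n _; apply: contrapT => nF; apply: nw; exists n => k nk Fk.
by apply: nF; exists k.
Qed.

Lemma leq_mul100_exp2 m : (10 <= m)%N -> (100 * m <= 2 ^ m)%N.
Proof.
move=> m10; rewrite -(subnK m10); elim: (m - 10)%N => // k IH.
by rewrite addSn expnS; move: IH; move: (2 ^ _)%N => u; lia.
Qed.

(** With [N = M] points and the threshold [S] of order [4 sqrt (N m)], the mean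
    number of bad pairs is at least [m]. *)
Lemma bad_rate_mul_ge (R : realType) (m N S : nat) (q : R) : (0 < m)%N ->
  (2 <= N)%N -> 1 <= q -> q ^+ 2 = N%:R * m%:R -> 4 * q <= S%:R + 1 ->
  m%:R <= N.-1%:R * bad_rate R S N.
Proof.
move=> m0 N2 q1 qE qS.
have Nr : 2 <= N%:R :> R by rewrite (ler_nat R 2).
have -> : N.-1%:R = N%:R - 1 :> R by rewrite -subn1 natrB // ltnW.
have N0 : N%:R != 0 :> R by rewrite pnatr_eq0; lia.
have SS : 8 * (N%:R * m%:R) <= (S * S.+1)%:R :> R.
  rewrite -qE natrM -[S.+1%:R]natr1.
  apply: (@le_trans _ _ ((4 * q - 1) * (4 * q))); first by nra.
  by apply: ler_pM; lra.
apply: (@le_trans _ _ ((N%:R - 1) * (8 * (N%:R * m%:R) / (2 * N%:R ^+ 2)))).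
  have -> : (N%:R - 1) * (8 * (N%:R * m%:R) / (2 * N%:R ^+ 2)) =
      4 * m%:R - 4 * m%:R / N%:R :> R by field.
  have : 4 * m%:R / N%:R <= 2 * m%:R :> R.
    rewrite ler_pdivrMr; last by lra.
    by have : 0 <= m%:R :> R by []; nra.
  by have : 0 <= m%:R :> R by []; lra.
apply: ler_wpM2l; first by lra.
by rewrite /bad_rate ler_pM2r // invr_gt0 mulr_gt0 // exprn_gt0; lra.
Qed.

Section AlmostSure.
Context d (T : measurableType d) (R : realType) (P : probability T R).
Variables (b : nat) (a : nat -> nat -> 'I_b) (pi : seq 'I_b -> T -> {perm 'I_b}).
Hypothesis b_gt1 : (1 < b)%N.
Hypothesis hpi : owen_permutations P pi.
Hypothesis a_inj : forall m j j', (j < b ^ m)%N -> (j' < b ^ m)%N ->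
  (forall r, (r < m)%N -> a j r = a j' r) -> j = j'.

Lemma prob_R_infty_large m : (10 <= m)%N ->
  (P [set w | (5 * Num.sqrt ((b ^ m)%:R * m%:R) / (b ^ m)%:R ^+ 2
       < R_infty (scrambled_points R (pi^~ w) a (b ^ m)))%R]
   <= (expR (- m%:R))%:E)%E.
Proof.
move=> m10.
have Nm : (100 * m <= b ^ m)%N.
  by apply: leq_trans (leq_mul100_exp2 m10) _; rewrite leq_exp2r //; lia.
set N := (b ^ m)%N in Nm *; pose q : R := Num.sqrt (N%:R * m%:R).
have qE : q ^+ 2 = N%:R * m%:R by rewrite sqr_sqrtr // mulr_ge0.
have q_ge0 : 0 <= q by exact: sqrtr_ge0.
have q1 : 1 <= q.
  rewrite -[leLHS]sqrtr1 ler_wsqrtr // -natrM ler1n muln_gt0.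
  by apply/andP; split; lia.
(* Five units of [q / N^2] leave room for [S.+1 <= 4 q + 1 <= 5 q]. *)
pose S := Num.truncn (4 * q).
have /andP[S_le lt_S] : S%:R <= 4 * q < S.+1%:R.
  by apply: truncn_itv; rewrite mulr_ge0.
have qN : 10 * q <= N%:R.
  rewrite -(ler_pXn2r (n := 2)) ?nnegrE ?mulr_ge0 // exprMn qE.
  have : (100 * m)%:R <= N%:R :> R by rewrite ler_nat.
  rewrite natrM [N%:R ^+ 2]expr2 => le100.
  by rewrite mulrCA -expr2 ler_wpM2l // (le_trans _ le100) // -natrX.
have S_small : (2 * S.+1 <= N)%N.
  rewrite -(ler_nat R) natrM -[S.+1%:R]natr1; apply: le_trans qN.
  by lra.
apply: le_trans (_ : P [set w | (S.+1%:R / N%:R ^+ 2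
       < R_infty (scrambled_points R (pi^~ w) a N))%R] <= _)%E.
  apply: le_measure; rewrite ?inE.
  - exact: (measurable_R_infty_gt a hpi N (5 * q / N%:R ^+ 2)).
  - exact: (measurable_R_infty_gt a hpi N (S.+1%:R / N%:R ^+ 2)).
  move=> w /=; apply: le_lt_trans; rewrite ler_wpM2r ?invr_ge0 ?exprn_ge0 //.
  by rewrite -/q -[S.+1%:R]natr1; lra.
apply: le_trans (prob_R_infty_gt hpi a_inj S_small) _.
rewrite lee_fin ler_expR lerN2; apply: (bad_rate_mul_ge _ _ q1 qE); [lia|lia|].
by rewrite natr1 ltW.
Qed.

Lemma ae_R_infty_pow : {ae P, forall w, exists n, forall m, (n <= m)%N ->
  R_infty (scrambled_points R (pi^~ w) a (b ^ m))
    <= 5 * Num.sqrt ((b ^ m)%:R * m%:R) / (b ^ m)%:R ^+ 2}.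
Proof.
(* The tail bound holds from [m = 10] on, hence the shift. *)
pose F k := [set w | (5 * Num.sqrt ((b ^ (k + 10))%:R * (k + 10)%:R)
    / (b ^ (k + 10))%:R ^+ 2
  < R_infty (scrambled_points R (pi^~ w) a (b ^ (k + 10))))%R].
have : {ae P, forall w, exists n, forall k, (n <= k)%N -> ~ F k w}.
  apply: (@ae_eventually_not _ _ _ _ _ (expR (- 1))).
  - by rewrite expR_ge0 expR_lt1 ltrN10.
  - by move=> k; exact: (measurable_R_infty_gt a hpi (b ^ (k + 10))).
  - move=> k; apply: le_trans (prob_R_infty_large (leq_addl k 10)) _.
    by rewrite lee_fin -expRM_natl ler_expR mulrN1 lerN2 ler_nat leq_addr.
apply: filterS => w [n hn]; exists (n + 10)%N => m nm; rewrite leNgt.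
have m10 : (10 <= m)%N by lia.
by apply/negP; rewrite -(subnK m10); apply: hn; lia.
Qed.

End AlmostSure.

Lemma powR_three_halves (R : realType) (y : R) : 0 < y ->
  y `^ (- (3 / 2)) = Num.sqrt y / y ^+ 2.
Proof.
move=> y0; rewrite -(powR12_sqrt (ltW y0)) -(powR_mulrn 2 (ltW y0)) -powRN.
rewrite (_ : - (3 / 2) = 2^-1 + - 2%:R); last by field.
by rewrite powRD ?(gt_eqF y0) ?implybT.
Qed.

(** Between two consecutive powers of [b] the separation radius is controlled by
    its value at the lower one. *)
Lemma R_infty_interpolate (R : realType) (b m n : nat) (f : nat -> R) :
  (1 < b)%N -> (0 < m)%N -> (b ^ m <= n < b ^ m.+1)%N ->
  R_infty (mkseq f (b ^ m)) <= 5 * Num.sqrt ((b ^ m)%:R * m%:R) / (b ^ m)%:R ^+ 2 ->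
  R_infty (mkseq f n) <= 5 * b%:R `^ (3 / 2) * ln b%:R `^ (- (1 / 2))
    * n%:R `^ (- (3 / 2)) * ln n%:R `^ (1 / 2).
Proof.
move=> b1 m0 /andP[Nn nN] Rm.
have b0 : (0 : R) < b%:R by rewrite ltr0n ltnW.
have N1 : (1 < b ^ m)%N by rewrite -[ltnLHS](exp1n m) ltn_exp2r.
have N0 : (0 : R) < (b ^ m)%:R by rewrite ltr0n ltnW.
have n0 : (0 : R) < n%:R by rewrite ltr0n; lia.
have lnb : 0 < ln b%:R :> R by rewrite ln_gt0 // ltr1n.
apply: le_trans (R_infty_mkseq_le f (m := b ^ m) _) _; first by rewrite N1.
apply: le_trans Rm _.
have sqrt_m : Num.sqrt m%:R <= ln b%:R `^ (- (1 / 2)) * ln n%:R `^ (1 / 2) :> R.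
  rewrite mul1r powRN ler_pdivlMl ?powR_gt0 // -powR12_sqrt //.
  rewrite -powRM ?ln_ge0 ?ler1n ?(ltnW b1) //.
  apply: ge0_ler_powR.
  - by rewrite invr_ge0.
  - by rewrite nnegrE mulr_ge0 // ltW.
  - by rewrite nnegrE ln_ge0 // ler1n -(ltr0n R).
  - by rewrite mulr_natr -lnXn // -natrX ler_ln ?posrE // ler_nat.
have powN : (b ^ m)%:R `^ (- (3 / 2)) <= b%:R `^ (3 / 2) * n%:R `^ (- (3 / 2)) :> R.
  rewrite !powRN ler_pdivlMr ?powR_gt0 // mulrC ler_pdivrMr ?powR_gt0 //.
  rewrite -powRM ?(ltW b0) ?(ltW N0) // -natrM -expnS.
  by rewrite ge0_ler_powR ?nnegrE ?divr_ge0 // ler_nat ltnW.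
have aux (c A B C D : R) : c * A * B * C * D = c * ((A * C) * (B * D)) by ring.
have aux' (c x y z : R) : c * (x * y) / z = c * ((x / z) * y) by ring.
rewrite sqrtrM ?(ltW N0) // aux' -powR_three_halves // aux.
by rewrite ler_wpM2l // ler_pM ?powR_ge0 ?sqrtr_ge0.
Qed.

(** The unit interval cannot be covered by [n] intervals shorter than [1 / n],
    so an upper bound on the separation radius is a lower bound on the mesh
    ratio. *)
Lemma rho_infty_ge (R : realType) (C : R) (s : seq R) :
  0 < C -> (1 < size s)%N ->
  R_infty s <= C * (size s)%:R `^ (- (3 / 2)) * ln (size s)%:R `^ (1 / 2) ->
  ((C^-1 * (size s)%:R `^ (1 / 2) * ln (size s)%:R `^ (- (1 / 2)))%:E
    <= rho_infty s)%E.
Proof.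
move=> C0 s1 Rs; rewrite /rho_infty; case: eqP => [_|/eqP R0]; first exact: leey.
have Rs0 : 0 < R_infty s by rewrite lt_def R0 R_infty_ge0.
have hs := h_infty_ge (ltnW s1).
set n : R := (size s)%:R in Rs hs *.
have n0 : 0 < n by rewrite ltr0n ltnW.
have L0 : 0 < ln n by rewrite ln_gt0 // ltr1n.
rewrite lee_fin ler_pdivlMr //.
apply: (@le_trans _ _ (2 * (2 * n)^-1)); last by rewrite ler_wpM2l.
set u := _ * _ `^ _ in Rs *.
have -> : 2 * (2 * n)^-1 = C^-1 * n `^ (1 / 2) * ln n `^ (- (1 / 2)) *
    (C * n `^ (- (3 / 2)) * ln n `^ (1 / 2)).
  have nE : n^-1 = n `^ (1 / 2) * n `^ (- (3 / 2)).
    rewrite -powRD ?(gt_eqF n0) ?implybT // -powR_inv1 ?ltW //.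
    by congr (powR _ _); field.
  have LE : 1 = ln n `^ (- (1 / 2)) * ln n `^ (1 / 2).
    by rewrite powRN mulVf // gt_eqF // powR_gt0.
  have aux (c x y z t : R) : c != 0 -> c^-1 * x * z * (c * y * t) = x * y * (z * t).
    by move=> ?; field.
  by rewrite aux ?gt_eqF // -nE -LE mulr1 invfM mulrA mulfV ?mul1r.
by rewrite ler_wpM2l // !mulr_ge0 ?powR_ge0 // invr_ge0 ltW.
Qed.


Theorem theorem4p1 (R : realType) (b : nat) (hb : (2 <= b)%N) :
  exists Cb cb : R, [/\ 0 < Cb, 0 < cb &
    forall (x : nat -> R) (a : nat -> nat -> 'I_b)
      (d : measure_display) (T : measurableType d) (P : probability T R)
      (pi : seq 'I_b -> T -> {perm 'I_b}),
      is_ts_sequence b 0 x ->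
      (forall j : nat, regular_expansion (x j) (a j)) ->
      owen_permutations P pi ->
      let Pt (n : nat) (w : T) : seq R :=
        scrambled_points R (fun u => pi u w) a n in
      (exists2 X : nat -> {RV P >-> R},
        (forall (m : nat) (w : T),
          X m w = b%:R `^ (3 * m%:R / 2) * R_infty (Pt (b ^ m)%N w)) &
        forall (d' : measure_display) (T' : measurableType d')
          (P' : probability T' R) (W : {RV P' >-> R}),
          is_weibull W 2 (1 / 2) -> cvg_in_distribution X W)
      /\
      (\forall w \ae P, \forall n \near \oo,
        R_infty (Pt n w) <= Cb * n%:R `^ (- (3 / 2)) * (ln n%:R) `^ (1 / 2)
        /\
        ((cb * n%:R `^ (1 / 2) * (ln n%:R) `^ (- (1 / 2)))%:E
          <= rho_infty (Pt n w))%E)].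
Proof.
pose C : R := 5 * b%:R `^ (3 / 2) * ln b%:R `^ (- (1 / 2)).
have C0 : 0 < C.
  have [b0 lnb0] : 0 < b%:R :> R /\ 0 < ln b%:R :> R.
    by rewrite ltr0n ltnW // ln_gt0 // ltr1n.
  by rewrite /C !mulr_gt0 // powR_gt0.
exists C, C^-1; split=> //; first by rewrite invr_gt0.
move=> x a d T P pi xnet areg hpi Pt.
have a_inj m := net_prefix_inj (m := m) xnet areg.
split; last first.
  apply: filterS (ae_R_infty_pow hb hpi a_inj) => w [m0 Rm0].
  exists (b ^ m0.+1)%N => // n /= Nn.
  have n_gt1 : (1 < n)%N.
    by apply: leq_trans Nn; rewrite -[ltnLHS](exp1n m0.+1) ltn_exp2r.
  have bounds := trunc_log_bounds hb (ltnW n_gt1).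
  have m0_le : (m0.+1 <= trunc_log b n)%N by exact: trunc_log_max.
  have Rn : R_infty (Pt n w) <= C * n%:R `^ (- (3 / 2)) * ln n%:R `^ (1 / 2).
    apply: (R_infty_interpolate hb (leq_ltn_trans (leq0n _) m0_le) bounds).
    exact/Rm0/ltnW.
  split=> //; have := @rho_infty_ge _ C (Pt n w) C0; rewrite size_mkseq.
  exact.
pose Rad m w := R_infty (Pt (b ^ m)%N w).
have mX m : measurable_fun setT (fun w => b%:R `^ (3 * m%:R / 2) * Rad m w).
  by apply: measurable_funM => //; exact: (measurable_R_infty_scrambled a hpi (b ^ m)).
pose X m : {RV P >-> R} := mfun_Sub (mem_set (mX m)).
exists X => // d' T' P' W hW t _.
rewrite (cdf_weibull t hW).
have [t0|t0] := lerP 0 t; last first.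
  rewrite (_ : (fun m => cdf (X m) t) = cst 0%E); first exact: cvg_cst.
  apply/funext => m; rewrite /cdf /distribution /pushforward /=.
  rewrite (_ : _ @^-1` _ = set0) ?measure0 //.
  apply/seteqP; split=> w //=; rewrite in_itv /= leNgt => /negP; apply.
  by apply: lt_le_trans t0 _; rewrite mulr_ge0 ?powR_ge0 ?R_infty_ge0.
rewrite (_ : (fun m => cdf (X m) t) = fun m => (1 - P [set w |
    (t < (Num.sqrt b%:R ^+ m) ^+ 3 * Rad m w)%R])%E).
  rewrite EFinB; apply: cvgeB => //; first exact: cvg_cst.
  exact: cvg_scaled_R_infty.
apply/funext => m; rewrite cdf_1_ccdf; congr (1 - P _)%E.
apply/seteqP; split=> w /=; rewrite in_itv /= andbT powR_mul3_half //.
Qed.
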